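(* Let $n=-2\ell-1$ with $\ell\in\mathbb{N}$, let $(B,d_B,\sigma^0)$ be a standard form cdga in $n$-shifted contact Darboux form, and let $\beta:B\to A$ be the submersion of standard form cdgas determined by a smooth morphism $\beta^0:B^0\to A^0$ with fiber coordinates $u^0_1,\dots,u^0_{n_0}$, variables $u^{-i}_j,v^{n+i}_j$ and a superpotential $G\in A^{n+1}$ (all data as described in the context). Then there is a canonical affine model for an $n$-shifted exact symplectic fibration structure on the map $\mathrm{Spec}\,\beta:\mathrm{Spec}\,A\to\mathrm{Spec}\,B$ of derived affine schemes over the $n$-shifted contact base $(\mathrm{Spec}\,B,\sigma^0)$, such that $\mathrm{Spec}\,A$ inherits a natural shifted contact structure. Explicitly: (1) The relative 1-form $\lambda_{rel}=\sum_{i,j}v_j^{n+i}\,d_{dR}u_j^{-i}$, with $$\gamma=d_{dR}\lambda_{rel}=\sum_{i,j}d_{dR}v_j^{n+i}\,d_{dR}u_j^{-i}\in\textstyle\bigwedge^2\Omega^1_{A/B}[n],$$ defines an $n$-shifted exact symplectic fibration structure on $\mathrm{Spec}\,\beta$. (2) With $$\Omega^0:=\sum_{i,j}v_j^{n+i}\,d_{dR}u_j^{-i}+\sum_{i,j}\tilde y_j^{n+i}\,d_{dR}\tilde x_j^{-i}+d_{dR}\hat z^n,$$ the 1-form $\alpha_A:=\Omega^0+c\cdot(\mathrm{Spec}\,\beta)^*(\sigma^0)$ defines an absolute $n$-shifted contact structure on $\mathrm{Spec}\,A$ for any constant $c\in\mathbb{K}\setminus\{-1\}$.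
   Context: **Conventions.** $\mathbb{K}$ is an algebraically closed field of characteristic zero; cdgas are over $\mathbb{K}$ and graded in non-positive degrees. A standard form cdga is a cdga whose degree 0 part $A(0)=A^0$ is a smooth $\mathbb{K}$-algebra and which is freely generated over $A(0)$ as a graded algebra by finitely many variables in negative degrees; for it $\mathbb{L}_A\simeq\Omega^1_A$. A submersion $B\to A$ of standard form cdgas is a morphism for which $\Omega^1_B\otimes_BA\to\Omega^1_A$ is injective in every degree. $d$ is the internal differential, $d_{dR}$ the de Rham differential, $d_{tot}=d+d_{dR}$. **Structures (untwisted, since all line bundles are trivialized here).** An $n$-shifted contact structure on $\mathrm{Spec}\,A$ is given by a 1-form $\alpha$ of degree $n$ such that, with $\mathcal{K}_A:=\mathrm{fib}(\alpha^\vee:\mathbb{T}_A\to\mathcal{O}[n])$, the restriction of $d_{dR}\alpha$ to $\mathcal{K}_A$ induces an equivalence $\mathcal{K}_A\simeq\mathcal{K}_A^\vee[n]$. An $n$-shifted exact symplectic fibration structure on $\mathrm{Spec}\,\beta:\mathrm{Spec}\,A\to\mathrm{Spec}\,B$ is a relative 1-form $\lambda$ of degree $n$ (relative forms being computed in $DR(A/B)\simeq\mathrm{Sym}_A(\Omega^1_{A/B}[-1])$) such that the closed relative 2-form $d_{dR}\lambda$ is non-degenerate, i.e. induces an equivalence $\mathbb{T}_{A/B}\to\mathbb{L}_{A/B}[n]$. **The base.** $B$ is a (minimal) standard form cdga: $B^0=B(0)$ is a smooth $\mathbb{K}$-algebra with étale coordinates $x^0_1,\dots,x^0_{m_0}$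 (so $d_{dR}x^0_j$ form a basis of $\Omega^1_{B(0)}$), and $B$ is free over $B(0)$ on variables $x_j^{-i}$ of degree $-i$ ($1\le i\le\ell$, $1\le j\le m_i$), $y_j^{n+i}$ of degree $n+i$ ($0\le i\le\ell$, $1\le j\le m_i$) and $\tilde z^n$ of degree $n$. A Hamiltonian $H\in B^{n+1}$ satisfying the classical master equation $\sum_{i=1}^{\ell}\sum_{j=1}^{m_i}\frac{\partial H}{\partial x_j^{-i}}\frac{\partial H}{\partial y_j^{n+i}}=0$ determines $d_B$ by $d_B|_{B(0)}=0$, $d_Bx_j^{-i}=\frac{\partial H}{\partial y_j^{n+i}}$ ($i>0$), $d_By_j^{n+i}=\frac{\partial H}{\partial x_j^{-i}}$, and $-n\,d_B\tilde z^n=H+d_B\big[\sum_{i,j}(-1)^i i\,x_j^{-i}y_j^{n+i}\big]$. The $n$-shifted contact form on $\mathrm{Spec}\,B$ is $\sigma^0=d_{dR}\tilde z^n+\sum_{i,j}y_j^{n+i}\,d_{dR}x_j^{-i}$. **The source.** $A^0=A(0)$ is a smooth $\mathbb{K}$-algebra of dimension $m_0+n_0$, $\beta^0:B^0\to A^0$ is a smooth morphism, $\tilde x^0_j:=\beta^0(x^0_j)$, and $u^0_1,\dots,u^0_{n_0}\in A^0$ are such that $\{d_{dR}\tilde x^0_j\}\cup\{d_{dR}u^0_j\}$ is an $A^0$-basis of $\Omega^1_{A^0}$. $A$ is the free graded algebra over $A^0$ on variables $\tilde x_j^{-i}$ (degree $-i$, $1\le i\le\ell$, $1\le j\le m_i$),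 $\tilde y_j^{n+i}$ (degree $n+i$, $0\le i\le\ell$, $1\le j\le m_i$), $\hat z^n$ (degree $n$), $u_j^{-i}$ (degree $-i$, $1\le i\le\ell$, $1\le j\le n_i$), $v_j^{n+i}$ (degree $n+i$, $0\le i\le\ell$, $1\le j\le n_i$). $\beta$ extends $\beta^0$ by $\beta(x_j^{-i})=\tilde x_j^{-i}$, $\beta(y_j^{n+i})=\tilde y_j^{n+i}$, $\beta(\tilde z^n)=\hat z^n$. The superpotential $G\in A^{n+1}$ depends only on the variables $u,v$ and satisfies the classical master equation $\sum_{i=1}^{\ell}\sum_{j=1}^{n_i}\frac{\partial G}{\partial u_j^{-i}}\frac{\partial G}{\partial v_j^{n+i}}=0$. The differential $d_A$ is given by $d_A|_{A^0}=0$, $d_A\tilde x_j^{-i}=\beta(d_Bx_j^{-i})$, $d_A\tilde y_j^{n+i}=\beta(d_By_j^{n+i})$, $d_A\hat z^n=\beta(d_B\tilde z^n)$, $d_Au_j^{-i}=\partial G/\partial v_j^{n+i}$ ($i>0$), $d_Av_j^{n+i}=\pm\,\partial G/\partial u_j^{-i}$, with the sign $\pm$ being that of the standard Darboux convention (as for $d_By_j^{n+i}$ in the base). Sums $\sum_{i,j}$ run over $0\le i\le\ell$ and all $j$.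
   Formalization: In (2), α_A is not d-closed for general G (ℓ=0, G=u²/2: dα_A = u d_dR u), so fib(α_A^∨) is undefined over A; the contact condition is stated over Spec A when dα_A=0, and otherwise only after restriction to Spec H^0(A). *)

(* Defs.v *)
From HB Require Import structures.
From mathcomp Require Import all_boot all_order all_algebra.
From mathcomp Require Import mpoly.
From mathcomp Require Import boolp functions.

Set Implicit Arguments.
Unset Strict Implicit.
Unset Printing Implicit Defensive.

Import GRing.Theory.
Local Open Scope ring_scope.

(* ksgn k v = (-1)^k v *)
Definition ksgn (V : zmodType) (k : int) (v : V) : V :=
  if odd `|k|%N then - v else v.

Section Smooth.

Definition formally_smooth (R S : comNzRingType) (f : {rmorphism R -> S}) :=
  forall (C D : comNzRingType) (p : {rmorphism C -> D})
         (h : {rmorphism R -> C}) (g : {rmorphism S -> D}),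
    (forall d, exists c, p c = d) ->
    (forall c c', p c = 0 -> p c' = 0 -> c * c' = 0) ->
    (forall r, p (h r) = g (f r)) ->
  exists g' : {rmorphism S -> C},
    (forall s, p (g' s) = g s) /\ (forall r, g' (f r) = h r).

Definition finitely_presented (R S : comNzRingType) (f : {rmorphism R -> S}) :=
  exists (n : nat) (x : 'I_n -> S),
    (forall s, exists q : {mpoly R[n]}, mmap f x q = s) /\
    exists (t : nat) (rel : 'I_t -> {mpoly R[n]}),
      forall q, mmap f x q = 0 <->
        exists c : 'I_t -> {mpoly R[n]}, q = \sum_k c k * rel k.

Definition smooth (R S : comNzRingType) (f : {rmorphism R -> S}) :=
  finitely_presented f /\ formally_smooth f.

Record kahler (K : fieldType) (R : comAlgType K) := Kahler {
  km :> lmodType R;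
  kd : R -> km;
  kd_add : forall a b, kd (a + b) = kd a + kd b;
  kd_scal : forall k : K, kd k%:A = 0;
  kd_mul : forall a b, kd (a * b) = a *: kd b + b *: kd a;
  kd_univ : forall (M : lmodType R) (D : R -> M),
    (forall a b, D (a + b) = D a + D b) ->
    (forall k : K, D k%:A = 0) ->
    (forall a b, D (a * b) = a *: D b + b *: D a) ->
    exists g : {linear km -> M}, (forall a, g (kd a) = D a) /\
      forall g' : {linear km -> M}, (forall a, g' (kd a) = D a) -> g' =1 g
}.

(* The family x gives etale coordinates: the d x_j are a basis of Omega^1.
   Kaehler modules being unique up to isomorphism, the choice of model is
   irrelevant. *)
Definition etale_coordinates (K : fieldType) (R : comAlgType K) (J : finType)
    (x : J -> R) :=
  exists Om : kahler R, forall w : Om,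
    exists! c : {ffun J -> R}, w = \sum_j c j *: kd Om (x j).

End Smooth.

Section GradedAlgebra.
Variable K : fieldType.

(* gdeg k is the subspace A^k; A is the direct sum of the A^k, k <= 0. *)
Record galg := GAlg {
  galg_alg :> algType K;
  gdeg : int -> galg_alg -> Prop;
  gdeg0 : forall k, gdeg k 0;
  gdegB : forall k a b, gdeg k a -> gdeg k b -> gdeg k (a - b);
  gdegZ : forall k (c : K) a, gdeg k a -> gdeg k (c *: a);
  gdeg1 : gdeg 0 1;
  gdegM : forall i j a b, gdeg i a -> gdeg j b -> gdeg (i + j) (a * b);
  gdeg_npos : forall k a, 0 < k -> gdeg k a -> a = 0;
  gdeg_dec : forall a, exists (N : nat) (h : nat -> galg_alg),
    (forall k : nat, gdeg (- k%:Z) (h k)) /\ a = \sum_(k < N) h k;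
  gdeg_direct : forall (N : nat) (h : nat -> galg_alg),
    (forall k : nat, gdeg (- k%:Z) (h k)) -> \sum_(k < N) h k = 0 ->
    forall k, (k < N)%N -> h k = 0;
  gcomm : forall i j a b, gdeg i a -> gdeg j b -> a * b = ksgn (i * j) (b * a)
}.

Record galgmor (A C : galg) := GAlgMor {
  gmor :> {lrmorphism A -> C};
  gmor_deg : forall k a, gdeg k a -> gdeg k (gmor a)
}.

Definition galg_id (A : galg) : galgmor A A :=
  @GAlgMor A A (idfun : {lrmorphism A -> A}) (fun _ _ h => h).

(* A graded module is the family of subgroups (mgr k) of an ambient module;
   only homogeneous elements of the ambient module are meaningful.  *)
Record gmod (A : galg) := GMod {
  gmod_car :> lmodType A;
  mgr : int -> gmod_car -> Prop;
  mgr0 : forall k, mgr k 0;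
  mgrB : forall k m m', mgr k m -> mgr k m' -> mgr k (m - m');
  mgrZ : forall i j a m, gdeg i a -> mgr j m -> mgr (i + j) (a *: m)
}.

Program Definition reg (A : galg) : gmod A :=
  @GMod A (A^o : lmodType A) (@gdeg A) (@gdeg0 A) (@gdegB A) _.
Next Obligation. exact: gdegM. Qed.

(* Graded f-semilinear maps of degree r; F k is the component on M^k, and
   F (a m) = (-1)^(r|a|) f(a) F(m). *)
Definition is_ghom (A C : galg) (f : galgmor A C) (M : gmod A) (N : gmod C)
    (r : int) (F : int -> M -> N) : Prop :=
  [/\ forall k m, mgr k m -> mgr (k + r) (F k m),
      forall k m m', mgr k m -> mgr k m' -> F k (m + m') = F k m + F k m' &
      forall i k a m, gdeg i a -> mgr k m ->
        F (i + k) (a *: m) = ksgn (r * i) (f a *: F k m)].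

(* Graded derivations of degree r along f, vanishing on S:
   D(ab) = (-1)^(r|a|) a D(b) + D(a) b, and
   D(a) b = (-1)^(|b|(|a|+r)) b D(a). *)
Definition is_gder (A C : galg) (f : galgmor A C) (M : gmod C) (S : A -> Prop)
    (r : int) (D : A -> M) : Prop :=
  [/\ forall a b, D (a + b) = D a + D b,
      forall k a, gdeg k a -> mgr (k + r) (D a),
      forall s, S s -> D s = 0 &
      forall i j a b, gdeg i a -> gdeg j b ->
        D (a * b) = ksgn (r * i) (f a *: D b)
                    + ksgn (j * (i + r)) (f b *: D a)].

(* Graded-symmetric f-bilinear maps of degree r; b i j is the component on
   M^i x M^j. *)
Definition is_symbil (A C : galg) (f : galgmor A C) (M : gmod A) (N : gmod C)
    (r : int) (b : int -> int -> M -> M -> N) : Prop :=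
  [/\ forall i j m m', mgr i m -> mgr j m' -> mgr (i + j + r) (b i j m m'),
      forall i j m1 m2 m', mgr i m1 -> mgr i m2 -> mgr j m' ->
        b i j (m1 + m2) m' = b i j m1 m' + b i j m2 m',
      forall t i j a m m', gdeg t a -> mgr i m -> mgr j m' ->
        b (t + i) j (a *: m) m' = ksgn (r * t) (f a *: b i j m m') &
      forall i j m m', mgr i m -> mgr j m' ->
        b j i m' m = ksgn (i * j) (b i j m m')].

Definition scalars (A : galg) : A -> Prop := fun a => exists k : K, a = k%:A.

Definition image_of (B A : galg) (f : galgmor B A) : A -> Prop :=
  fun a => exists b, a = f b.

End GradedAlgebra.

Section DGModules.
Variable K : fieldType.

Record cdga := Cdga {
  cdga_galg :> galg K;
  cd : cdga_galg -> cdga_galg;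
  cd_der : is_gder (galg_id cdga_galg) (M := reg cdga_galg)
             (scalars (A := cdga_galg)) 1 cd;
  cd_sq : forall a, cd (cd a) = 0
}.

Record cdgamor (A C : cdga) := CdgaMor {
  cmor :> galgmor A C;
  cmor_d : forall a, cmor (cd a) = cd (cmor a)
}.

Definition cdga_id (A : cdga) : cdgamor A A :=
  @CdgaMor A A (galg_id A) (fun _ => erefl).

(* md k is the differential M^k -> M^(k+1). *)
Record dgmod (A : cdga) := DGMod {
  dgmod_gmod :> gmod A;
  md : int -> dgmod_gmod -> dgmod_gmod;
  md_deg : forall k m, mgr k m -> mgr (k + 1) (md k m);
  md_add : forall k m m', mgr k m -> mgr k m' ->
    md k (m + m') = md k m + md k m';
  md_leibniz : forall i k a m, gdeg i a -> mgr k m ->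
    md (i + k) (a *: m) = cd a *: m + ksgn i (a *: md k m);
  md_sq : forall k m, mgr k m -> md (k + 1) (md k m) = 0
}.

Definition is_dgmor (A : cdga) (M N : dgmod A) (F : int -> M -> N) : Prop :=
  is_ghom (galg_id A) 0 F /\
  forall k m, mgr k m -> F (k + 1) (md k m) = md k (F k m).

Definition quasi_iso (A : cdga) (M N : dgmod A) (F : int -> M -> N) : Prop :=
  forall k,
    (forall m, mgr k m -> md k m = 0 ->
       (exists2 n, mgr (k - 1) n & F k m = md (k - 1) n) ->
       exists2 m', mgr (k - 1) m' & m = md (k - 1) m') /\
    (forall n, mgr k n -> md k n = 0 ->
       exists m n', [/\ mgr k m, md k m = 0, mgr (k - 1) n' &
                        n = F k m + md (k - 1) n']).

Definition is_equivalence (A : cdga) (M N : dgmod A) (F : int -> M -> N) :=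
  is_dgmor F /\ quasi_iso F.

Lemma ksgn0 (V : zmodType) k : ksgn k (0 : V) = 0.
Proof. by rewrite /ksgn oppr0 if_same. Qed.

Lemma ksgnD (V : zmodType) k (u v : V) : ksgn k (u + v) = ksgn k u + ksgn k v.
Proof. by rewrite /ksgn; case: ifP => // _; rewrite opprD. Qed.

Lemma ksgnN (V : zmodType) k (u : V) : ksgn k (- u) = - ksgn k u.
Proof. by rewrite /ksgn; case: ifP. Qed.

Lemma ksgnZ (R : pzRingType) (V : lmodType R) k (a : R) (v : V) :
  a *: ksgn k v = ksgn k (a *: v).
Proof. by rewrite /ksgn; case: ifP => // _; rewrite scalerN. Qed.

Lemma odd_absD (i j : int) : odd `|(i + j)%R|%N = odd `|i|%N (+) odd `|j|%N.
Proof.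
have aux (p q : nat) : odd `|(p%:Z - q%:Z)%R|%N = odd p (+) odd q.
  have [le_qp|/ltnW le_pq] := leqP q p.
    by rewrite distnEl // oddB.
  by rewrite distnEr // oddB // addbC.
case: i j => i [] j; rewrite ?NegzE.
- by rewrite -PoszD !absz_nat oddD.
- by rewrite abszN !absz_nat aux.
- by rewrite addrC abszN !absz_nat aux addbC.
- by rewrite -opprD abszN -PoszD !abszN !absz_nat oddD.
Qed.

Lemma odd_absM (i j : int) : odd `|(i * j)%R|%N = odd `|i|%N && odd `|j|%N.
Proof. by rewrite abszM oddM. Qed.

Lemma ksgn_ksgn (V : zmodType) i j (v : V) :
  ksgn i (ksgn j v) = ksgn (i + j) v.
Proof.
by rewrite /ksgn odd_absD; case: odd; case: odd => //=; rewrite opprK.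
Qed.

Lemma eq_ksgn (V : zmodType) i j (v : V) :
  odd `|i|%N = odd `|j|%N -> ksgn i v = ksgn j v.
Proof. by rewrite /ksgn => ->. Qed.

Section ModuleTheory.
Variables (A : cdga) (M : dgmod A).
Implicit Types (m : M) (k : int).

Lemma mgrN k m : mgr k m -> mgr k (- m).
Proof. by move=> hm; rewrite -(add0r (- m)); apply: mgrB => //; apply: mgr0. Qed.

Lemma mgrD k m m' : mgr k m -> mgr k m' -> mgr k (m + m').
Proof. by move=> hm hm'; rewrite -(opprK m'); apply: mgrB => //; apply: mgrN. Qed.

Lemma mgr_ksgn i k m : mgr k m -> mgr k (ksgn i m).
Proof. by rewrite /ksgn; case: ifP => // _; apply: mgrN. Qed.

Lemma md0 k : md k (0 : M) = 0.
Proof.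
have h0 := mgr0 M k.
by apply: (@addrI _ (md k (0 : M))); rewrite -md_add // !addr0.
Qed.

Lemma mdN k m : mgr k m -> md k (- m) = - md k m.
Proof.
move=> hm; apply: (@addrI _ (md k m)).
by rewrite -md_add ?subrr ?md0 //; apply: mgrN.
Qed.

Lemma md_ksgn i k m : mgr k m -> md k (ksgn i m) = ksgn i (md k m).
Proof. by move=> hm; rewrite /ksgn; case: ifP => // _; rewrite mdN. Qed.

End ModuleTheory.

Lemma gdeg_cd (A : cdga) k (a : A) : gdeg k a -> gdeg (k + 1) (cd a).
Proof. by case: (cd_der A) => _ h _ _; apply: h. Qed.

Definition regd (A : cdga) : dgmod A.
Proof.
refine (@DGMod A (reg A) (fun _ a => cd (a : A)) _ _ _ _).
- by move=> k m hm; apply: gdeg_cd.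
- by move=> k m m' _ _; case: (cd_der A) => h _ _ _; apply: h.
- move=> i k a m ha hm; case: (cd_der A) => _ _ _ h.
  rewrite (h i k a m ha hm) /= addrC mul1r.
  have hda : gdeg (i + 1) (cd a) by apply: gdeg_cd.
  by congr (_ + _); rewrite [X in _ = X](gcomm hda hm) mulrC.
- by move=> k m _; apply: cd_sq.
Defined.

(* M[n].  The differential and the action are those of M, without the Koszul
   sign (-1)^n: the result is isomorphic, by m |-> (-1)^(n|m|) m, to the
   shift with signs. *)
Definition shift_gmod (A : cdga) (n : int) (M : dgmod A) : gmod A.
Proof.
refine (@GMod K A M (fun k => @mgr K A M (k + n)) _ _ _).
- by move=> k; apply: mgr0.
- by move=> k m m'; apply: mgrB.
- by move=> i j a m ha hm; rewrite -addrA; apply: mgrZ.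
Defined.

Definition shift (A : cdga) (n : int) (M : dgmod A) : dgmod A.
Proof.
refine (@DGMod A (shift_gmod n M) (fun k => @md A M (k + n)) _ _ _ _).
- by move=> k m hm /=; rewrite addrAC; apply: md_deg.
- by move=> k m m' hm hm'; apply: md_add.
- by move=> i k a m ha hm /=; rewrite -addrA; apply: md_leibniz.
- by move=> k m hm /=; rewrite addrAC; apply: md_sq.
Defined.

(* fib(F) = M + N[-1].  With the sign (-1)^k in front of F the action of A is
   componentwise. *)
Definition fib_gmod (A : cdga) (M N : dgmod A) : gmod A.
Proof.
refine (@GMod K A (M * N)%type
          (fun k x => mgr k x.1 /\ mgr (k - 1) x.2) _ _ _).
- by move=> k; split; apply: mgr0.
- by move=> k x y [? ?] [? ?]; split; apply: mgrB.
- move=> i j a x ha [? ?]; split; first exact: mgrZ.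
  by rewrite -addrA; apply: mgrZ.
Defined.

Definition fib (A : cdga) (M N : dgmod A) (F : int -> M -> N)
  (hF : is_dgmor F) : dgmod A.
Proof.
refine (@DGMod A (fib_gmod M N)
  (fun k x => (md k x.1, ksgn k (F k x.1) + md (k - 1) x.2)) _ _ _ _);
  case: hF => -[F1 F2 F3] F4.
- move=> k [m n] /= [hm hn]; split; first exact: md_deg.
  rewrite addrK; apply: mgrD; last by rewrite -[k in mgr k _](subrK 1); apply: md_deg.
  by apply: mgr_ksgn; rewrite -[k in mgr k _]addr0; apply: F1.
- move=> k [m n] [m' n'] /= [hm hn] [hm' hn'].
  rewrite !md_add // F2 // ksgnD; congr pair => /=.
  by rewrite addrACA.
- move=> i k a [m n] /= ha [hm hn].
  have e : ksgn i (a *: ((md k m, ksgn k (F k m) + md (k - 1) n) : M * N)) =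
           (ksgn i (a *: md k m),
            ksgn (i + k) (a *: F k m) + ksgn i (a *: md (k - 1) n)).
    rewrite -ksgn_ksgn -ksgnD -[ksgn k (a *: _)]ksgnZ -scalerDr /ksgn.
    by case: (odd `|i|).
  rewrite e; congr pair => /=; first exact: md_leibniz.
  rewrite -addrA md_leibniz // F3 // mul0r.
  by rewrite addrCA.
- move=> k [m n] /= [hm hn]; congr pair => /=; first exact: md_sq.
  have hFm : mgr k (F k m) by rewrite -[k in mgr k _]addr0; apply: F1.
  rewrite F4 // addrK md_add.
  - have e : md k (md (k - 1) n) = 0 by rewrite -{1}(subrK 1 k); apply: md_sq.
    rewrite md_ksgn // e addr0.
    by rewrite /ksgn odd_absD /=; case: odd; rewrite /= ?addNr ?subrr.
  - exact: mgr_ksgn.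
  - by rewrite -[k in mgr k _](subrK 1); apply: md_deg.
Defined.

(* Hom_f(M, N): in degree r, the f-semilinear maps of degree r.  So that
   equality is equality of graded maps, F k is required to be 0 outside M^k.
   dF = d o F - (-1)^r F o d. *)
Definition hom_gr (A C : cdga) (f : cdgamor A C) (M : dgmod A) (N : dgmod C)
    (r : int) (F : int -> M -> N) : Prop :=
  is_ghom f r F /\ forall k m, ~ mgr k m -> F k m = 0.

Definition hom_d (A C : cdga) (M : dgmod A) (N : dgmod C)
    (r : int) (F : int -> M -> N) : int -> M -> N :=
  fun k m => if `[< mgr k m >]
             then md (k + r) (F k m) - ksgn r (F (k + 1) (md k m)) else 0.

Definition hom_gmod (A C : cdga) (f : cdgamor A C) (M : dgmod A)
  (N : dgmod C) : gmod C.
Proof.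
refine (@GMod K C (int -> M -> N) (@hom_gr A C f M N) _ _ _).
- move=> r; split=> //; split=> [k m _|k m m' _ _|i k a m _ _].
  + exact: mgr0.
  + by rewrite addr0.
  + by rewrite /= scaler0 ksgn0.
- move=> r F G [[F1 F2 F3] F4] [[G1 G2 G3] G4]; split; last first.
    by move=> k m hm; rewrite /= !fctE F4 // G4 // subr0.
  split=> [k m hm|k m m' hm hm'|i k a m ha hm]; rewrite !fctE.
  + by apply: mgrB; [apply: F1|apply: G1].
  + by rewrite F2 // G2 // opprD addrACA.
  + by rewrite F3 // G3 // scalerBr ksgnD ksgnN.
- move=> i r c F hc [[F1 F2 F3] F4]; split; last first.
    by move=> k m hm; rewrite /= !fctE F4 // scaler0.
  split=> [k m hm|k m m' hm hm'|j k a m ha hm]; rewrite !fctE.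
  + by rewrite addrCA; apply: mgrZ => //; apply: F1.
  + by rewrite F2 // scalerDr.
  + have hfa : gdeg j (f a) by apply: gmor_deg.
    rewrite F3 // ksgnZ scalerA (gcomm hc hfa) /ksgn.
    rewrite mulrDl odd_absD !odd_absM.
    by case: (odd `|i|); case: (odd `|j|); case: (odd `|r|);
       rewrite /= ?scalerA ?scaleNr ?opprK.
Defined.

Definition hom (A C : cdga) (f : cdgamor A C) (M : dgmod A) (N : dgmod C) :
  dgmod C.
Proof.
refine (@DGMod C (hom_gmod f M N) (@hom_d A C M N) _ _ _ _).
- move=> r F [[F1 F2 F3] F4]; split; last first.
    by move=> k m hm; rewrite /hom_d; case: asboolP.
  split=> [k m hm|k m m' hm hm'|i k a m ha hm]; rewrite /hom_d.
  + rewrite asboolT //; apply: mgrB.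
      by rewrite addrA; apply: md_deg; apply: F1.
    apply: mgr_ksgn; rewrite (addrC r) addrA; apply: F1.
    exact: md_deg.
  + rewrite !asboolT //; last exact: mgrD.
    rewrite F2 // !md_add //; try exact: F1.
    by rewrite F2 ?ksgnD ?opprD 1?addrACA //; apply: md_deg.
  + have hda := gdeg_cd ha; have hdm := md_deg hm.
    have hfa : gdeg i (f a) by apply: gmor_deg.
    have hdam : mgr (i + k + 1) (cd a *: m).
      by rewrite addrAC; apply: mgrZ.
    have hadm : mgr (i + k + 1) (a *: md k m).
      by rewrite -addrA; apply: mgrZ.
    rewrite !asboolT //; last exact: mgrZ.
    rewrite md_leibniz // F2 //; last exact: mgr_ksgn.
    have eF : F (i + k + 1) (ksgn i (a *: md k m)) =
              ksgn i (F (i + k + 1) (a *: md k m)).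
      rewrite /ksgn; case: ifP => // _.
      apply: (@addrI _ (F (i + k + 1) (a *: md k m))).
      rewrite subrr -F2 // ?subrr; last exact: mgrN.
      apply: (@addrI _ (F (i + k + 1) 0)).
      by rewrite -F2 ?addr0 //; apply: mgr0.
    have e1 : F (i + k + 1) (cd a *: m) =
              ksgn (r * (i + 1)) (f (cd a) *: F k m).
      by rewrite addrAC F3.
    have e2 : F (i + k + 1) (a *: md k m) =
              ksgn (r * i) (f a *: F (k + 1) (md k m)).
      by rewrite -addrA F3.
    rewrite eF e1 e2 F3 // -!addrA.
    rewrite md_ksgn; last by apply: mgrZ => //; apply: F1.
    rewrite md_leibniz //; last exact: F1.
    rewrite -cmor_d scalerBr !ksgnZ !ksgnD !ksgnN !ksgn_ksgn.
    set u := f (cd a) *: _; set v := f a *: _; set w := f a *: _.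
    rewrite [ksgn (r + _) u](@eq_ksgn _ _ (r * i)); last first.
      by rewrite !(odd_absD, odd_absM) /= andbC; case: odd; case: odd.

    have -> : (r + 1) * i = r * i + i by rewrite mulrDl mul1r.
    rewrite opprD addrACA subrr add0r; congr (_ - _).
    by rewrite addrC (addrC r i) addrA.
- move=> r F G [[F1 F2 F3] F4] [[G1 G2 G3] G4].
  apply/funext => k; apply/funext => m; rewrite /hom_d !fctE.
  case: asboolP => hm; last by rewrite addr0.
  rewrite !md_add ?ksgnD ?opprD 1?addrACA //; [exact: F1|exact: G1].
- move=> i r c F hc [[F1 F2 F3] F4].
  apply/funext => k; apply/funext => m.
  have -> : (cd c *: F + ksgn i (c *: hom_d r F)) k m =
            cd c *: F k m + ksgn i (c *: hom_d r F k m).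
    by rewrite /ksgn; case: ifP.
  rewrite /hom_d; case: asboolP => hm; last first.
    by rewrite F4 // !scaler0 ksgn0 addr0.
  rewrite !fctE addrCA md_leibniz //; last exact: F1.
  by rewrite scalerBr ksgnD ksgnN ksgnZ ksgn_ksgn addrA.
- move=> r F [[F1 F2 F3] F4].
  apply/funext => k; apply/funext => m; rewrite /hom_d.
  case: asboolP => // hm; have hdm := md_deg hm.
  rewrite asboolT // md_sq //.
  have -> : F (k + 1 + 1) 0 = 0.
    apply: (@addrI _ (F (k + 1 + 1) 0)).
    by rewrite -F2 ?addr0 //; apply: mgr0.
  rewrite ksgn0 subr0.
  have h1 : mgr (k + r + 1) (md (k + r) (F k m)) by apply/md_deg/F1.
  have h2 : mgr (k + r + 1) (F (k + 1) (md k m)).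
    by rewrite addrAC; apply: F1.
  rewrite [k + (r + 1)]addrA md_add //; last exact/mgrN/mgr_ksgn.
  rewrite md_sq ?add0r; last exact: F1.
  rewrite mdN ?md_ksgn //; last exact: mgr_ksgn.
  rewrite [k + r + 1]addrAC /ksgn odd_absD /=.
  by case: odd; rewrite /= ?opprK ?subrr ?addNr.
Defined.

Definition dual (A : cdga) (M : dgmod A) : dgmod A :=
  hom (cdga_id A) M (regd A).

End DGModules.

Section DeRham.
Variable K : fieldType.

(* A model of DR(A/S) = Sym_A(Omega^1_{A/S}[-1]) in weights <= 2, where the
   elements of S are the constants (S = K gives DR(A), S = beta(B) gives
   DR(A/B)).  Everything is graded by the total degree (cohomological degree
   plus weight): om1 is Omega^1[-1], so that a 1-form of degree n has total
   degree n + 1; om2 is Sym^2_A(om1), i.e. the second exterior power of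
   Omega^1 shifted by -2, and a 2-form of degree n has total degree n + 2.
   With these degrees d_dR is an odd derivation anticommuting with d.
   om1 and om2 are characterized by their universal properties among graded
   modules over arbitrary graded A-algebras; the lifts om1_lift and om2_lift
   are only meaningful on derivations, resp. symmetric bilinear maps. *)
Record deRham (A : cdga K) (S : A -> Prop) := DeRham {
  om1 : dgmod A;
  dR : A -> om1;
  dR_der : is_gder (galg_id A) S 1 dR;
  dR_d : forall k a, gdeg k a -> md (k + 1) (dR a) = - dR (cd a);
  om1_lift : forall (C : galg K) (f : galgmor A C) (M : gmod C) (r : int),
    (A -> M) -> int -> om1 -> M;
  om1_liftP : forall (C : galg K) (f : galgmor A C) (M : gmod C) r D,
    is_gder (M := M) f S r D ->
    is_ghom f (r - 1) (om1_lift f r D) /\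
    forall k a, gdeg k a -> om1_lift f r D (k + 1) (dR a) = D a;
  om1_uniq : forall (C : galg K) (f : galgmor A C) (M : gmod C) r
      (g g' : int -> om1 -> M),
    is_ghom f r g -> is_ghom f r g' ->
    (forall k a, gdeg k a -> g (k + 1) (dR a) = g' (k + 1) (dR a)) ->
    forall k w, mgr k w -> g k w = g' k w;

  om2 : dgmod A;
  wedge : om1 -> om1 -> om2;
  wedge_symbil : is_symbil (galg_id A) 0 (fun _ _ => wedge);
  wedge_d : forall i j w w', mgr i w -> mgr j w' ->
    md (i + j) (wedge w w') = wedge (md i w) w' + ksgn i (wedge w (md j w'));
  om2_lift : forall (C : galg K) (f : galgmor A C) (M : gmod C) (r : int),
    (int -> int -> om1 -> om1 -> M) -> int -> om2 -> M;
  om2_liftP : forall (C : galg K) (f : galgmor A C) (M : gmod C) r b,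
    is_symbil (N := M) f r b ->
    is_ghom f r (om2_lift f r b) /\
    forall i j w w', mgr i w -> mgr j w' ->
      om2_lift f r b (i + j) (wedge w w') = b i j w w';
  om2_uniq : forall (C : galg K) (f : galgmor A C) (M : gmod C) r
      (g g' : int -> om2 -> M),
    is_ghom f r g -> is_ghom f r g' ->
    (forall i j w w', mgr i w -> mgr j w' ->
       g (i + j) (wedge w w') = g' (i + j) (wedge w w')) ->
    forall k w, mgr k w -> g k w = g' k w;

  dR1 : int -> om1 -> om2;
  dR1_deg : forall k w, mgr k w -> mgr (k + 1) (dR1 k w);
  dR1_add : forall k w w', mgr k w -> mgr k w' ->
    dR1 k (w + w') = dR1 k w + dR1 k w';
  dR1_mul : forall i k a w, gdeg i a -> mgr k w ->
    dR1 (i + k) (a *: w) = wedge (dR a) w + ksgn i (a *: dR1 k w);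
  dR1_dR : forall k a, gdeg k a -> dR1 (k + 1) (dR a) = 0
}.

Section Tangent.
Variables (A : cdga K) (S : A -> Prop) (O : deRham S).

(* The tangent complex with coefficients in a cdga C over A, i.e.
   T_{A/S} (x)_A C = Hom_A(Omega^1_{A/S}, C) (Omega^1 is finite free for
   standard form cdgas).  An element X of degree k is the contraction
   operator om1 -> C, of total degree k - 1. *)
Definition tangent (C : cdga K) (f : cdgamor A C) : dgmod C :=
  shift (-1)%R (hom f (om1 O) (regd C)).

(* X |-> i_X(omega), for omega of degree n, where
   i_X(w w') = X(w) w' + (-1)^(|w||w'|) X(w') w. *)
Definition contraction (n : int) (omega : om2 O)
    (k : int) (X : tangent (cdga_id A)) : om1 O :=
  om2_lift (galg_id A) (M := om1 O) (k - 1)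
    (fun i j w w' => X i w *: w' + ksgn (i * j) (X j w' *: w)) (n + 2) omega.

Variables (C : cdga K) (f : cdgamor A C).

(* i_Y(i_X(omega)) for X, Y of degrees k, l with values in C: on products,
   i_Y i_X (w w') = (-1)^((l-1)(|w|+k-1)) X(w) Y(w')
                    + (-1)^((k-1)|w|) Y(w) X(w'). *)
Definition pairing (n : int) (omega : om2 O)
    (k l : int) (X Y : tangent f) : C :=
  om2_lift f (M := reg C) (k - 1 + (l - 1))
    (fun i j w w' =>
       ksgn ((l - 1) * (i + (k - 1))) ((X i w : C) * (Y j w' : C))
       + ksgn ((k - 1) * i) ((Y i w : C) * (X j w' : C))) (n + 2) omega.

(* d(alpha) (x) 1 = 0 in Omega^1 (x)_A C *)
Definition closed_on (n : int) (alpha : om1 O) : Prop :=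
  forall k (X : tangent f), mgr k X ->
    X (n + 1 + 1) (md (n + 1) alpha) = 0.

(* alpha^vee : T (x)_A C -> C[n] *)
Definition form_dual (n : int) (alpha : om1 O) (k : int) (X : tangent f) :
  shift n (regd C) := X (n + 1) alpha.

Lemma form_dual_dgmor n alpha :
  mgr (n + 1) alpha -> closed_on n alpha -> is_dgmor (form_dual n alpha).
Proof.
move=> hal hcl; split; first split.
- move=> k X [[X1 _ _] _]; rewrite /= addr0.
  have := X1 _ _ hal; rewrite /form_dual /=.
  by have -> : n + 1 + (k + - 1) = k + n by rewrite addrACA subrr addr0 addrC.
- by [].
- by move=> i k a X _ _; rewrite mul0r.
- move=> k X hX; have hcX := hcl _ _ hX.
  by rewrite /form_dual /= /hom_d asboolT // hcX ksgn0 subr0.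
Qed.

(* K_A (x)_A C = fib(alpha^vee) *)
Definition contact_fib n alpha (hal : mgr (n + 1) alpha)
    (hcl : closed_on n alpha) : dgmod C :=
  fib (form_dual_dgmor hal hcl).

(* The map K -> K^vee[n] induced by a 2-form omega of degree n on
   K = contact_fib, i.e. the composite K -> T -> Omega^1[n] -> K^vee[n]:
   (X, x) |-> ((Y, y) |-> +- i_Y i_X omega).  The Koszul sign makes it linear
   and compatible with the differentials. *)
Definition fib_pairing n alpha (hal : mgr (n + 1) alpha)
    (hcl : closed_on n alpha) (omega : om2 O)
    (k : int) (Xx : contact_fib hal hcl) :
    shift n (dual (contact_fib hal hcl)) :=
  fun l Yy => if `[< mgr l Yy >]
              then ksgn (k + (n + k) * l) (pairing n omega k l Xx.1 Yy.1)
              else 0.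

Definition contact_over (n : int) (alpha : om1 O) : Prop :=
  exists (hal : mgr (n + 1) alpha) (hcl : closed_on n alpha),
    is_equivalence
      (fib_pairing (hal := hal) (hcl := hcl) (dR1 (n + 1) alpha)).

End Tangent.

(* pi exhibits C as the truncation H^0(A) of A *)
Definition is_H0 (A C : cdga K) (pi : cdgamor A C) : Prop :=
  [/\ forall c : C, gdeg 0 c,
      forall c : C, exists2 a : A, gdeg 0 a & pi a = c &
      forall a : A, gdeg 0 a ->
        (pi a = 0 <-> exists2 b : A, gdeg (- 1) b & a = cd b)].

(* n-shifted contact structure defined by a 1-form alpha of degree n.
   When d alpha = 0, so that alpha^vee : T_A -> A[n] is a map of dg-modules,
   this says that d_dR alpha induces an equivalence K_A ~ K_A^vee[n] for
   K_A = fib(alpha^vee).  (The clause over H^0(A) is then a consequence.)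
   When alpha is a 1-form whose closedness only holds after restriction to
   the truncation Spec H^0(A), fib(alpha^vee) only exists there, and it is
   there that K and its nondegeneracy are considered. *)
Definition is_contact (A : cdga K) (O : deRham (scalars (A := A)))
    (n : int) (alpha : om1 O) : Prop :=
  [/\ mgr (n + 1) alpha,
      forall (C : cdga K) (pi : cdgamor A C), is_H0 pi ->
        contact_over pi n alpha &
      md (n + 1) alpha = 0 -> contact_over (cdga_id A) n alpha].

(* n-shifted exact symplectic fibration structure on Spec A -> Spec B defined
   by a relative 1-form lambda of degree n: the 2-form d_dR lambda is closed
   (d_dR (d_dR lambda) = 0 is automatic) and T_{A/B} -> L_{A/B}[n] is an
   equivalence. *)
Definition is_exact_symplectic_fibration (B A : cdga K) (beta : cdgamor B A)
    (O : deRham (image_of beta)) (n : int) (lambda : om1 O) : Prop :=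
  [/\ mgr (n + 1) lambda,
      md (n + 2) (dR1 (n + 1) lambda) = 0 &
      is_equivalence (M := tangent O (cdga_id A)) (N := shift (n + 1) (om1 O))
        (contraction n (dR1 (n + 1) lambda))].

(* beta^* on 1-forms of degree n: the map with b d_dR b' |->
   beta(b) d_dR beta(b'). *)
Definition pullback (B A : cdga K) (beta : cdgamor B A)
    (OB : deRham (scalars (A := B))) (OA : deRham (scalars (A := A)))
    (n : int) (w : om1 OB) : om1 OA :=
  om1_lift beta (M := om1 OA) 1 (fun b => dR OA (beta b)) (n + 1) w.

End DeRham.

Section StandardForm.
Variable K : fieldType.

(* A is free, as a graded commutative algebra over iota(A0), on the finite
   family w of homogeneous elements: the monomials in which the exponents of
   the odd variables are at most 1 form a basis of A over A0. *)
Definition monomial (A : algType K) (I : finType) (w : I -> A)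
    (e : {ffun I -> nat}) : A := \prod_i w i ^+ e i.

Definition freely_generated (A : algType K) (A0 : comAlgType K)
    (iota : {lrmorphism A0 -> A}) (I : finType) (deg : I -> int)
    (w : I -> A) : Prop :=
  let admissible (e : {ffun I -> nat}) :=
    forall i, odd `|deg i|%N -> (e i <= 1)%N in
  (forall a : A, exists (s : seq {ffun I -> nat}) (c : {ffun I -> nat} -> A0),
     (forall e, e \in s -> admissible e) /\
     a = \sum_(e <- s) iota (c e) * monomial w e) /\
  (forall (s : seq {ffun I -> nat}) (c : {ffun I -> nat} -> A0),
     uniq s -> (forall e, e \in s -> admissible e) ->
     \sum_(e <- s) iota (c e) * monomial w e = 0 ->
     forall e, e \in s -> c e = 0).

(* A standard form cdga with global coordinates w c (c in I) of degree deg c: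
   those of degree 0 are etale coordinates on A(0), those of negative degree
   are free generators over A(0).  D c is the partial derivative with respect
   to w c: the (left) graded derivation with D c (w c') = delta. *)
Record std_coords (A : cdga K) (I : finType) (deg : I -> int) := StdCoords {
  sc_alg0 : comAlgType K;
  sc_iota : {lrmorphism sc_alg0 -> A};
  sc_w : I -> A;
  sc_w0 : {c : I | deg c == 0} -> sc_alg0;
  sc_D : I -> A -> A;
  sc_smooth : smooth (GRing.in_alg sc_alg0 : {rmorphism K -> sc_alg0});
  sc_iota_inj : injective sc_iota;
  sc_iota_im : forall a : A, gdeg 0 a <-> exists a0, a = sc_iota a0;
  sc_deg_le0 : forall c, deg c <= 0;
  sc_w_deg : forall c, gdeg (deg c) (sc_w c);
  sc_w0E : forall c, sc_iota (sc_w0 c) = sc_w (val c);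
  sc_etale : etale_coordinates sc_w0;
  sc_free : freely_generated sc_iota
              (fun c : {c : I | deg c < 0} => deg (val c))
              (fun c => sc_w (val c));
  sc_D_der : forall c, is_gder (galg_id A) (M := reg A) (scalars (A := A))
                         (- deg c) (sc_D c);
  sc_D_w : forall c c', sc_D c (sc_w c') = (c == c')%:R
}.

End StandardForm.

Section Darboux.
Variables (K : fieldType) (l : nat).

(* n = -2l - 1 *)
Definition nshift : int := - (l.*2.+1)%:Z.

(* pairs (i, j) with 0 <= i <= l and j < m i *)
Definition dindex (m : 'I_l.+1 -> nat) : Type := {i : 'I_l.+1 & 'I_(m i)}.

Definition bcoord (m : 'I_l.+1 -> nat) : Type :=
  (dindex m + dindex m + unit)%type.

Definition cx m (p : dindex m) : bcoord m := inl (inl p).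
Definition cy m (p : dindex m) : bcoord m := inl (inr p).
Definition cz m : bcoord m := inr tt.

Definition deg_pos m (p : dindex m) : int := - (tag p : nat)%:Z.
Definition deg_mom m (p : dindex m) : int := nshift + (tag p : nat)%:Z.

Definition bdeg m (c : bcoord m) : int :=
  match c with
  | inl (inl p) => deg_pos p
  | inl (inr p) => deg_mom p
  | inr _ => nshift
  end.

Definition acoord (m q : 'I_l.+1 -> nat) : Type :=
  (bcoord m + (dindex q + dindex q))%type.

Definition cb m q (c : bcoord m) : acoord m q := inl c.
Definition cu m q (p : dindex q) : acoord m q := inr (inl p).
Definition cv m q (p : dindex q) : acoord m q := inr (inr p).

Definition adeg m q (c : acoord m q) : int :=
  match c with
  | inl c => bdeg c
  | inr (inl p) => deg_pos p
  | inr (inr p) => deg_mom p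
  end.

(* B is in n-shifted contact Darboux form, with m i variables x^{-i} and
   m i variables y^{n+i}. *)
Record contact_darboux (m : 'I_l.+1 -> nat) (B : cdga K) := ContactDarboux {
  cd_coords :> std_coords B (bdeg (m := m));
  cd_H : B;
  base_x := fun p => sc_w cd_coords (cx p);
  base_y := fun p => sc_w cd_coords (cy p);
  base_z := sc_w cd_coords (cz m);
  cd_H_deg : gdeg (nshift + 1) cd_H;
  cd_master : \sum_(p : dindex m | (0 < tag p)%N)
    sc_D cd_coords (cx p) cd_H * sc_D cd_coords (cy p) cd_H = 0;
  cd_dx : forall p : dindex m, (0 < tag p)%N ->
    cd (base_x p) = sc_D cd_coords (cy p) cd_H;
  cd_dy : forall p : dindex m, cd (base_y p) = sc_D cd_coords (cx p) cd_H;
  cd_dz : ((- nshift)%:~R : K) *: (cd base_z : B) =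
    cd_H + cd (\sum_(p : dindex m)
      ((-1) ^+ (tag p) * (tag p)%:R : K) *: (base_x p * base_y p))
}.

Definition contact_form m (B : cdga K) (DB : contact_darboux m B)
    (O : deRham (scalars (A := B))) : om1 O :=
  dR O (base_z DB) + \sum_(p : dindex m) base_y DB p *: dR O (base_x DB p).

(* The data beta : B -> A, with q i fiber variables u^{-i} and q i fiber
   variables v^{n+i}; the remaining coordinates of A are the images under beta
   of those of B.  In degree 0 this says that the d x~^0_j and d u^0_j form a
   basis of Omega^1 of A(0), which is then of dimension m 0 + q 0. *)
Record darboux_submersion (m q : 'I_l.+1 -> nat) (B : cdga K)
    (DB : contact_darboux m B) (A : cdga K) := DarbouxSubmersion {
  ds_coords :> std_coords A (adeg (m := m) (q := q));
  ds_beta : cdgamor B A;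
  ds_beta0 : {lrmorphism sc_alg0 DB -> sc_alg0 ds_coords};
  ds_beta0_smooth : smooth ds_beta0;
  ds_betaE : forall b, ds_beta (sc_iota DB b) = sc_iota ds_coords (ds_beta0 b);
  ds_base : forall c, sc_w ds_coords (cb q c) = ds_beta (sc_w DB c);
  ds_G : A;
  src_u := fun p => sc_w ds_coords (cu m p);
  src_v := fun p => sc_w ds_coords (cv m p);
  src_x := fun p => sc_w ds_coords (cb q (cx p));
  src_y := fun p => sc_w ds_coords (cb q (cy p));
  src_z := sc_w ds_coords (cb q (cz m));
  ds_G_deg : gdeg (nshift + 1) ds_G;
  ds_G_uv : forall c : bcoord m, sc_D ds_coords (cb q c) ds_G = 0;
  ds_master : \sum_(p : dindex q | (0 < tag p)%N)
    sc_D ds_coords (cu m p) ds_G * sc_D ds_coords (cv m p) ds_G = 0;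
  ds_du : forall p : dindex q, (0 < tag p)%N ->
    cd (src_u p) = sc_D ds_coords (cv m p) ds_G;
  ds_dv : forall p : dindex q, cd (src_v p) = sc_D ds_coords (cu m p) ds_G
}.

End Darboux.

(* Main.v *)
(* All the complexes involved are free on explicit coordinates.  Partial
   derivatives show that the forms dR w, w ranging over the coordinates, are a
   basis of Omega^1: derivations of A(0) are controlled by the etale
   coordinates, and the rest of A is free over A(0).

   Since n is odd a Hamiltonian h has even degree, so dR h is the sum of the
   D_c h dR w_c without signs, and dR (dR h) = 0 says that the 2-form
   dR v dR u is d-closed.

   In the relative case contraction with this 2-form exchanges the basis
   vectors, so it is an isomorphism of complexes.  In the absolute case
   alpha = \sum kappa v dR u + (1 + c) dR z with all kappa in {1, 1 + c}, and
   d_dR alpha is degenerate exactly along the vector field of z.  As 1 + c is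
   invertible this field can be rescaled to a Reeb field R, which is a cycle
   with alpha(R) = 1; it splits T as ker(alpha) + A.R, the fibre of alpha
   retracts onto ker(alpha), and there the pairing is perfect. *)

Require Import Defs.
From HB Require Import structures.
From mathcomp Require Import all_boot all_order all_algebra.
From mathcomp Require Import mpoly.
From mathcomp Require Import boolp functions.
From mathcomp Require Import zify ring.

Set Implicit Arguments.
Unset Strict Implicit.
Unset Printing Implicit Defensive.

Import Order.TTheory GRing.Theory Num.Theory.
Local Open Scope ring_scope.

(** The contact condition has two clauses: one over H^0(A), and one over A under the hypothesis d
    alpha = 0. Tangent complexes are therefore taken with coefficients in a cdga C over A, and alpha
    is only assumed closed on C; the cases C = H^0(A) and C = A give the two clauses. Over H^0(A)
    closedness has to be proved. Elements of negative degree and boundaries die there, which leaves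
    dR (dz); the equation defining dz controls it after division by -n, and this is where
    characteristic zero enters.

    The pairing on the fibre T + C[n-1] ignores the second summand and the direction of R, so it is
    not bijective, and the equivalence comes from an explicit homotopy contracting these two pieces
    against each other. That R is a cycle is a count of degrees: n is the lowest degree of a
    coordinate, so the coefficients of the differential of R would lie in positive degree.

    Closedness is known for the sum of the dR v dR u belonging to one Hamiltonian, not for its
    summands; arguments made summand by summand must first add the vanishing term coming from the
    whole sum. *)

Lemma odd_absN (i : int) : odd `|(- i)%R|%N = odd `|i|%N.
Proof. by rewrite abszN. Qed.

(** Signs are carried as integer exponents of [ksgn], so an identity of Koszul signs becomes a
    Boolean identity in the parities of the degrees, settled by cases. *)
Ltac parity :=
  rewrite ?(odd_absD, odd_absM, odd_absN) /= ?andbT ?andbF ?addbF ?addbT;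
  repeat match goal with
  | |- context [odd `|?x|%N] => case: (odd `|x|%N)
  end; rewrite //=.

(** * Graded modules and signs *)

Section Signs.

Lemma ksgn_sum (V : zmodType) k (I : Type) (s : seq I) (P : pred I) (F : I -> V) :
  ksgn k (\sum_(i <- s | P i) F i) = \sum_(i <- s | P i) ksgn k (F i).
Proof. by rewrite /ksgn; case: ifP => // _; rewrite sumrN. Qed.

Lemma raddf_ksgn (U V : zmodType) (f : {additive U -> V}) k u :
  f (ksgn k u) = ksgn k (f u).
Proof. by rewrite /ksgn; case: ifP => // _; rewrite raddfN. Qed.

Lemma ksgn_scale (R : pzRingType) (V : lmodType R) k (a : R) (v : V) :
  ksgn k a *: v = ksgn k (a *: v).
Proof. by rewrite /ksgn; case: ifP => // _; rewrite scaleNr. Qed.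

Lemma ksgn_mulr (R : pzRingType) k (a b : R) : a * ksgn k b = ksgn k (a * b).
Proof. by rewrite /ksgn; case: ifP => // _; rewrite mulrN. Qed.

Lemma ksgn_mull (R : pzRingType) k (a b : R) : ksgn k a * b = ksgn k (a * b).
Proof. by rewrite /ksgn; case: ifP => // _; rewrite mulNr. Qed.

Lemma ksgn_even (V : zmodType) k (v : V) : ~~ odd `|k|%N -> ksgn k v = v.
Proof. by rewrite /ksgn => /negbTE ->. Qed.

Lemma ksgn_odd (V : zmodType) k (v : V) : odd `|k|%N -> ksgn k v = - v.
Proof. by rewrite /ksgn => ->. Qed.

Lemma ksgnK (V : zmodType) k : involutive (@ksgn V k).
Proof. by move=> v; rewrite ksgn_ksgn ksgn_even //; parity. Qed.

End Signs.

Section GradedModules.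
Variable K : fieldType.

Section OneModule.
Variables (A : galg K) (M : gmod A).

Lemma gmodN k (m : M) : mgr k m -> mgr k (- m).
Proof. by move=> h; rewrite -(add0r (- m)); apply: mgrB => //; apply: mgr0. Qed.

Lemma gmodD k (m m' : M) : mgr k m -> mgr k m' -> mgr k (m + m').
Proof. by move=> h h'; rewrite -(opprK m'); apply: mgrB => //; apply: gmodN. Qed.

Lemma gmod_ksgn i k (m : M) : mgr k m -> mgr k (ksgn i m).
Proof. by rewrite /ksgn; case: ifP => // _; apply: gmodN. Qed.

Lemma gmod_sum k (I : Type) (s : seq I) (P : pred I) (F : I -> M) :
  (forall i, P i -> mgr k (F i)) -> mgr k (\sum_(i <- s | P i) F i).
Proof.
by move=> h; apply: big_ind => //; [exact: mgr0|exact: gmodD].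
Qed.

Lemma gmodZ i j k a (m : M) : gdeg i a -> mgr j m -> k = i + j -> mgr k (a *: m).
Proof. by move=> ha hm ->; apply: mgrZ. Qed.

End OneModule.

Lemma gdegM_eq (A : galg K) i j k (a b : A) :
  gdeg i a -> gdeg j b -> k = i + j -> gdeg k (a * b).
Proof. by move=> ha hb ->; apply: gdegM. Qed.

Lemma gdeg_scalar (A : galg K) (k : K) : gdeg 0 (k%:A : A).
Proof. by apply: gdegZ; apply: gdeg1. Qed.

Lemma gmodK (A : galg K) (M : gmod A) k (c : K) (m : M) :
  mgr k m -> mgr k (c%:A *: m).
Proof. by move=> hm; apply: gmodZ (gdeg_scalar _ _) hm (esym (add0r _)). Qed.

(** Grouping the terms by degree and subtracting [a] in the slot of degree [k] gives a homogeneous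
    family with sum zero, to which directness of the sum applies. Terms of positive degree vanish by
    themselves. *)
Lemma gdeg_component (A : galg K) (T : eqType) (s : seq T) (t : T -> A)
    (d : T -> int) k (a : A) :
  gdeg k a -> (forall e, gdeg (d e) (t e)) -> a = \sum_(e <- s) t e ->
  a = \sum_(e <- s | d e == k) t e.
Proof.
move=> ha ht eqa.
have [kpos|kneg] := ltP 0 k.
  rewrite (gdeg_npos kpos ha) big1 // => e /eqP de.
  by apply: (@gdeg_npos _ _ k) => //; rewrite -de.
have [k0 ek] : exists k0 : nat, k = - k0%:Z.
  by exists `|k|%N; rewrite abszE ler0_norm ?opprK.
(* [N] exceeds [k0] and every [|d e|], so the truncated sum misses no component. *)
pose N := (maxn k0 (\max_(e <- s) `|d e|%N)).+1.
pose h (j : nat) : A := \sum_(e <- s | d e == - j%:Z) t e - (if j == k0 then a else 0).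
have hh j : gdeg (- j%:Z) (h j).
  apply: gdegB; last by case: eqP => [->|_]; [rewrite -ek|apply: gdeg0].
  have := @gmod_sum A (reg A) (- j%:Z) T s (fun e => d e == - j%:Z) t; apply=> e /eqP
    <-; exact: ht.
have h0 : \sum_(j < N) h j = 0.
  rewrite /h sumrB; apply/eqP; rewrite subr_eq0; apply/eqP.
  transitivity a; last first.
    have k0N : (k0 < N)%N by rewrite ltnS leq_maxl.
    rewrite (bigD1 (Ordinal k0N)) //= eqxx big1 ?addr0 // => j.
    by rewrite -val_eqE /= => /negbTE ->.
  rewrite eqa (exchange_big_dep xpredT) //=; apply: eq_big_seq => e es.
  have [dpos|dneg] := ltP 0 (d e).
    rewrite [RHS](gdeg_npos dpos (ht e)) big1 // => j _.
    exact: gdeg_npos dpos (ht e).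
  have jN : (`|d e| < N)%N.
    by rewrite ltnS leq_max; apply/orP; right; apply: leq_bigmax_seq.
  rewrite (bigD1 (Ordinal jN)) /=; last by apply/eqP; lia.
  rewrite big1 ?addr0 // => j /andP[/eqP dj]; rewrite -val_eqE /= => /eqP; lia.
have k0N : (k0 < N)%N by rewrite ltnS leq_maxl.
have /eqP := gdeg_direct hh h0 k0N.
by rewrite /h eqxx subr_eq0 -ek => /eqP.
Qed.

(** The one-term sum [a], declared of degree [j], has no term of degree [i]. *)
Lemma gdeg_inj (A : galg K) i j (a : A) : gdeg i a -> gdeg j a -> i != j -> a = 0.
Proof.
move=> hi hj nij.
rewrite (@gdeg_component A unit [:: tt] (fun=> a) (fun=> j) i a) ?big_seq1 //.
by rewrite big_cons big_nil (negbTE (_ : j != i)) // eq_sym.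
Qed.

End GradedModules.

(** * Derivations in coordinates *)

Section RestrictionOfScalars.

(** The universal property of [kahler] quantifies over modules over A(0). A derivation with values
    in a module over C reaches it through this synonym, on which A(0) acts by way of A(0) -> C. *)
Definition restrict (R S : pzRingType) (g : {rmorphism R -> S}) (M : lmodType S)
  : Type := M.

Variables (R S : pzRingType) (g : {rmorphism R -> S}) (M : lmodType S).

HB.instance Definition _ := GRing.Zmodule.on (restrict g M).

Let restrict_scale (a : R) (m : restrict g M) : restrict g M := g a *: (m : M).

Let restrict_scaleA a b m :
  restrict_scale a (restrict_scale b m) = restrict_scale (a * b) m.
Proof. by rewrite /restrict_scale scalerA rmorphM. Qed.

Let restrict_scale1 : left_id 1 restrict_scale.
Proof. by move=> m; rewrite /restrict_scale rmorph1 scale1r. Qed.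

Let restrict_scaleDr : right_distributive restrict_scale +%R.
Proof. by move=> a m m'; rewrite /restrict_scale scalerDr. Qed.

Let restrict_scaleDl m : {morph restrict_scale^~ m : a b / a + b}.
Proof. by move=> a b; rewrite /restrict_scale rmorphD scalerDl. Qed.

HB.instance Definition _ :=
  GRing.Zmodule_isLmodule.Build R (restrict g M)
    restrict_scaleA restrict_scale1 restrict_scaleDr restrict_scaleDl.

End RestrictionOfScalars.

Section Derivations.
Variable K : fieldType.

Section Ghom.
Variables (A C : galg K) (f : galgmor A C) (M : gmod A) (N : gmod C) (r : int).
Variable F : int -> M -> N.
Hypothesis hF : is_ghom f r F.

Lemma ghom_deg k j m : mgr k m -> j = k + r -> mgr j (F k m).
Proof. by case: hF => h _ _ hm ->; apply: h. Qed.

Lemma ghomD k m m' : mgr k m -> mgr k m' -> F k (m + m') = F k m + F k m'.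
Proof. by case: hF => _ h _; apply: h. Qed.

Lemma ghom0 k : F k 0 = 0.
Proof. by apply: (@addrI _ (F k 0)); rewrite -ghomD ?addr0 //; apply: mgr0. Qed.

Lemma ghomZ i k j a m : gdeg i a -> mgr k m -> j = i + k ->
  F j (a *: m) = ksgn (r * i) (f a *: F k m).
Proof. by case: hF => _ _ h ha hm ->; apply: h. Qed.

Lemma ghomN k m : mgr k m -> F k (- m) = - F k m.
Proof.
move=> hm; apply: (@addrI _ (F k m)).
by rewrite -ghomD ?subrr ?ghom0 //; apply: gmodN.
Qed.

Lemma ghomB k m m' : mgr k m -> mgr k m' -> F k (m - m') = F k m - F k m'.
Proof. by move=> hm hm'; rewrite ghomD ?ghomN //; apply: gmodN. Qed.

Lemma ghom_ksgn i k m : mgr k m -> F k (ksgn i m) = ksgn i (F k m).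
Proof. by move=> hm; rewrite /ksgn; case: ifP; rewrite ?ghomN. Qed.

Lemma ghom_sum k (I : Type) (s : seq I) (P : pred I) (G : I -> M) :
  (forall i, P i -> mgr k (G i)) ->
  F k (\sum_(i <- s | P i) G i) = \sum_(i <- s | P i) F k (G i).
Proof.
move=> hG; elim: s => [|i s IH]; first by rewrite !big_nil ghom0.
rewrite !big_cons; case: ifP => // Pi; rewrite ghomD ?IH //; first exact: hG.
exact: gmod_sum.
Qed.

Lemma ghomK k (c : K) m : mgr k m -> F k (c%:A *: m) = c%:A *: F k m.
Proof.
move=> hm; rewrite (@ghomZ 0 k) ?add0r //; last exact: gdeg_scalar.
by rewrite mulr0 ksgn_even // linearZ rmorph1.
Qed.

End Ghom.

Section Der.
Variables (A C : galg K) (f : galgmor A C) (M : gmod C) (S : A -> Prop) (r : int).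
Variable D : A -> M.
Hypothesis hD : is_gder f S r D.

Lemma gderD a b : D (a + b) = D a + D b.
Proof. by case: hD. Qed.

Lemma gder0 : D 0 = 0.
Proof. by apply: (@addrI _ (D 0)); rewrite -gderD !addr0. Qed.

Lemma gderN a : D (- a) = - D a.
Proof. by apply: (@addrI _ (D a)); rewrite -gderD !subrr gder0. Qed.

Lemma gder_ksgn k a : D (ksgn k a) = ksgn k (D a).
Proof. by rewrite /ksgn; case: ifP => // _; rewrite gderN. Qed.

Lemma gder_sum (I : Type) (s : seq I) (P : pred I) (G : I -> A) :
  D (\sum_(i <- s | P i) G i) = \sum_(i <- s | P i) D (G i).
Proof. exact: (big_morph D gderD gder0). Qed.

Lemma gder_deg k j a : gdeg k a -> j = k + r -> mgr j (D a).
Proof. by case: hD => _ h _ _ ha ->; apply: h. Qed.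

Lemma gder_const s : S s -> D s = 0.
Proof. by case: hD => _ _ h _; apply: h. Qed.

Lemma gderM i j a b : gdeg i a -> gdeg j b ->
  D (a * b) = ksgn (r * i) (f a *: D b) + ksgn (j * (i + r)) (f b *: D a).
Proof. by case: hD => _ _ _ h; apply: h. Qed.

Lemma gderS (S' : A -> Prop) : (forall s, S' s -> S s) -> is_gder f S' r D.
Proof. by move=> sS; case: hD => h1 h2 h3 h4; split=> // s /sS; apply: h3. Qed.

End Der.

Lemma scalar_in (A : galg K) (k : K) : scalars (k%:A : A).
Proof. by exists k. Qed.

Lemma gderK (A C : galg K) (f : galgmor A C) (M : gmod C) r (D : A -> M)
    (k : K) a i : is_gder f (@scalars K A) r D -> gdeg i a -> D (k *: a) = k%:A *: D a.
Proof.
move=> hD ha; rewrite -[k *: a]mulr_algl (gderM hD (gdeg_scalar A k) ha).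
rewrite (gder_const hD (scalar_in A k)) scaler0 ksgn0 addr0 mulr0 ksgn_even //.
by rewrite linearZ rmorph1.
Qed.

Lemma gderM_reg (A C : galg K) (f : galgmor A C) (S : A -> Prop) r
    (D : A -> C) i j a b :
  is_gder (M := reg C) f S r D -> gdeg i a -> gdeg j b ->
  D (a * b) = ksgn (r * i) (f a * D b) + ksgn (j * (i + r)) (f b * D a).
Proof. move=> hD; exact: (@gderM A C f (reg C) S r D hD i j a b). Qed.

Lemma gmor_ksgn (A C : galg K) (f : galgmor A C) k a :
  f (ksgn k a) = ksgn k (f a).
Proof. exact: raddf_ksgn. Qed.

Lemma gmorD (A C : galg K) (f : galgmor A C) a b : f (a + b) = f a + f b.
Proof. exact: raddfD. Qed.

Lemma gmorM (A C : galg K) (f : galgmor A C) a b : f (a * b) = f a * f b.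
Proof. exact: rmorphM. Qed.

Section Expansion.
Variables (A : cdga K) (I : finType) (deg : I -> int) (X : std_coords A deg).
Variables (C : galg K) (f : galgmor A C) (M : gmod C) (r : int) (D : A -> M).
Hypothesis hD : is_gder f (@scalars K A) r D.

(* The sign is that of moving D (w_c) to the right of its coefficient. *)
Definition expands (k : int) (a : A) : Prop :=
  D a = \sum_c ksgn ((r + deg c) * (k + deg c)) (f (sc_D X c a) *: D (sc_w X c)).

Lemma expands_sum k (J : Type) (s : seq J) (P : pred J) (F : J -> A) :
  (forall j, P j -> expands k (F j)) -> expands k (\sum_(j <- s | P j) F j).
Proof.
move=> hF; rewrite /expands (gder_sum hD) (eq_bigr _ (fun j Pj => hF j Pj)).
rewrite exchange_big /=; apply: eq_bigr => c _.
by rewrite (gder_sum (sc_D_der X c)) -ksgn_sum linear_sum scaler_suml.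
Qed.

(** The Leibniz rules of [D] and of each partial derivative match term by term. The degree is a
    parameter of [expands] because the sign in the expansion depends on it. *)
Lemma expandsM i j a b : gdeg i a -> gdeg j b ->
  expands i a -> expands j b -> expands (i + j) (a * b).
Proof.
move=> ha hb ea eb; rewrite /expands (gderM hD ha hb) ea eb.
rewrite !scaler_sumr !ksgn_sum -big_split /=; apply: eq_bigr => c _.
rewrite (gderM_reg (sc_D_der X c) ha hb) /= gmorD !gmor_ksgn !gmorM.
rewrite scalerDl ksgnD !ksgnZ !ksgn_scale !ksgn_ksgn !scalerA.
by congr (_ + _); apply: eq_ksgn; parity.
Qed.

Lemma expands1 : expands 0 1.
Proof.
rewrite /expands -(scale1r 1) (gder_const hD (scalar_in A 1)) big1 // => c _.
by rewrite (gder_const (sc_D_der X c) (scalar_in A 1)) raddf0 scale0r ksgn0.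
Qed.

Lemma expands_w c : expands (deg c) (sc_w X c).
Proof.
rewrite /expands (bigD1 c) //= sc_D_w eqxx rmorph1 scale1r.
rewrite ksgn_even; last by parity.
rewrite big1 ?addr0 // => c' /negbTE nc.
by rewrite sc_D_w nc raddf0 scale0r ksgn0.
Qed.

End Expansion.

Section Degree0.
Variables (A : cdga K) (I : finType) (deg : I -> int) (X : std_coords A deg).

Lemma sc_iota_deg a0 : gdeg 0 (sc_iota X a0).
Proof. by apply/sc_iota_im; exists a0. Qed.

(* The coefficients co do not depend on the derivation D: they are read off by
   taking for D the coordinate derivations. *)
Lemma der_iota (a0 : sc_alg0 X) : exists co : {c : I | deg c == 0} -> sc_alg0 X,
  forall (C : galg K) (f : galgmor A C) (M : gmod C) (r : int) (D : A -> M),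
    is_gder f (@scalars K A) r D ->
    D (sc_iota X a0) = \sum_c f (sc_iota X (co c)) *: D (sc_w X (val c)).
Proof.
have [Om hOm] := sc_etale X.
have [co [ed _]] := hOm (kd Om a0).
exists co => C f M r D hD.
pose g : {rmorphism sc_alg0 X -> C} := f \o sc_iota X.
pose N := restrict g M.
pose D0 (a : sc_alg0 X) : N := D (sc_iota X a).
have D0D a b : D0 (a + b) = D0 a + D0 b.
  by rewrite /D0 rmorphD (gderD hD).
have D0K (k : K) : D0 k%:A = 0.
  by rewrite /D0 linearZ rmorph1 (gder_const hD (scalar_in A k)).
have D0M a b : D0 (a * b) = a *: D0 b + b *: D0 a.
  rewrite /D0 rmorphM (gderM hD (sc_iota_deg a) (sc_iota_deg b)).
  by rewrite !ksgn_even ?mulr0 ?mul0r.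
have [G [hG _]] := kd_univ Om D0D D0K D0M.
rewrite -[LHS]hG ed linear_sum; apply: eq_bigr => c _.
by rewrite linearZ hG /D0 sc_w0E.
Qed.

Variables (C : galg K) (f : galgmor A C) (M : gmod C) (r : int) (D : A -> M).
Hypothesis hD : is_gder f (@scalars K A) r D.

Lemma expands_iota a0 : expands X f r D 0 (sc_iota X a0).
Proof.
have [co hco] := der_iota a0.
rewrite /expands (hco _ _ _ _ _ hD).
rewrite (bigID (fun c => deg c == 0)) /= [X in _ = _ + X]big1 ?addr0; last first.
  (* A derivative along a coordinate of negative degree sends degree 0 to positive degree, where A
     vanishes. *)
  move=> c nc; have := gder_deg (sc_D_der X c) (sc_iota_deg a0) erefl.
  rewrite add0r => /gdeg_npos -> //; first by rewrite raddf0 scale0r ksgn0.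
  by rewrite oppr_gt0 lt_neqAle nc (sc_deg_le0 X).
rewrite [RHS](reindex_omap (val : {c : I | deg c == 0} -> I) insub) /=; last first.
  by move=> c c0; rewrite insubT.
apply: eq_big => [[c c0] | [c c0] _] /=; first by rewrite insubT c0 eqxx.
rewrite (eqP c0) !addr0 mulr0 ksgn_even //; congr (f _ *: _).
rewrite (hco _ _ _ _ _ (sc_D_der X c)) (bigD1 (exist _ c c0)) //= sc_D_w eqxx.
rewrite big1 ?addr0; first exact: (esym (mulr1 _)).
move=> [c' c0']; rewrite -val_eqE /= => nc.
by rewrite sc_D_w eq_sym (negbTE nc) scaler0.
Qed.

(** The expansion holds on A(0) and on the generators and passes to products, hence to monomials
    with coefficients. Since it is tied to a degree, the monomials of other degrees must be
    discarded before summing, which [gdeg_component] allows. *)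
Lemma der_expansion k a : gdeg k a -> expands X f r D k a.
Proof.
move=> ha; have [gen _] := sc_free X; have [s [c [_ ea]]] := gen a.
pose d (e : {ffun {c : I | deg c < 0} -> nat}) := \sum_i deg (val i) *+ e i.
have hmon e : gdeg (d e) (monomial (fun c => sc_w X (val c)) e) /\
    expands X f r D (d e) (monomial (fun c => sc_w X (val c)) e).
  rewrite /monomial /d; elim: index_enum => [|i t [IHd IHe]].
    by rewrite !big_nil; split; [exact: gdeg1|exact: expands1].
  rewrite !big_cons.
  have [hXd hXe] : gdeg (deg (val i) *+ e i) (sc_w X (val i) ^+ e i) /\
      expands X f r D (deg (val i) *+ e i) (sc_w X (val i) ^+ e i).
    elim: (e i) => [|p [IHd' IHe']].
      by rewrite mulr0n expr0; split; [exact: gdeg1|exact: expands1].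
    rewrite mulrS exprS; split; first by apply: gdegM => //; apply: sc_w_deg.
    by apply: expandsM => //; [apply: sc_w_deg|apply: expands_w].
  by split; [apply: gdegM|apply: expandsM].
have hterm e : gdeg (d e) (sc_iota X (c e) * monomial (fun c => sc_w X (val c)) e) /\
    expands X f r D (d e) (sc_iota X (c e) * monomial (fun c => sc_w X (val c)) e).
  have [hmd hme] := hmon e; have hi := sc_iota_deg (c e).
  split; first by apply: (gdegM_eq hi hmd); rewrite add0r.
  by rewrite -[d e]add0r; apply: expandsM => //; apply: expands_iota.
rewrite (gdeg_component ha (fun e => (hterm e).1) ea).
by apply: expands_sum => // e /eqP <-; case: (hterm e).
Qed.

End Degree0.

End Derivations.

(** * Bases of one-forms *)

Section Frames.
Variable K : fieldType.
Variables (A : cdga K) (S : A -> Prop) (O : deRham S).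
Hypothesis scS : forall s : A, scalars s -> S s.

(* fr_phi is the basis dual to the dR (w j); the sign in fr_expand is that of
   moving dR (w j) to the right of its coefficient. *)
Record frame (J : finType) (deg : J -> int) (w : J -> A) := Frame {
  fr_phi : J -> int -> om1 O -> A;
  fr_deg : forall j, gdeg (deg j) (w j);
  fr_ghom : forall j, is_ghom (N := reg A) (galg_id A) (- deg j - 1) (fr_phi j);
  fr_dual : forall j j', fr_phi j (deg j' + 1) (dR O (w j')) = (j == j')%:R;
  fr_expand : forall k om, mgr k om ->
    om = \sum_j ksgn ((deg j + 1) * (k + deg j + 1)) (fr_phi j k om *: dR O (w j))
}.

Lemma dR_deg k j a : gdeg k a -> j = k + 1 -> mgr j (dR O a).
Proof. exact: (gder_deg (dR_der O)). Qed.

Lemma dR_const s : S s -> dR O s = 0.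
Proof. exact: (gder_const (dR_der O)). Qed.

Lemma dR_M i j a b : gdeg i a -> gdeg j b ->
  dR O (a * b) = ksgn i (a *: dR O b) + ksgn (j * (i + 1)) (b *: dR O a).
Proof. by move=> ha hb; rewrite (gderM (dR_der O) ha hb) mul1r. Qed.

Section Extension.
Variables (J : finType) (deg : J -> int) (w : J -> A) (F : frame deg w).
Variables (C : galg K) (f : galgmor A C) (M : gmod C) (r : int) (x : J -> M).
Hypothesis hx : forall j, mgr (deg j + 1 + r) (x j).

(** The sign combines the one in [fr_expand] with the Koszul sign of a map of degree [r] moving past
    the coefficient. *)
Definition frame_ext (k : int) (om : om1 O) : M :=
  \sum_j ksgn ((r + deg j + 1) * (k + deg j + 1)) (f (fr_phi F j k om) *: x j).

Lemma frame_ext_ghom : is_ghom f r frame_ext.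
Proof.
rewrite /frame_ext; split.
- move=> k m hm; apply: gmod_sum => j _; apply/gmod_ksgn/gmodZ => //.
    by apply: gmor_deg; apply: (ghom_deg (fr_ghom F j) hm).
  ring.
- move=> k m m' hm hm'; rewrite -big_split /=; apply: eq_bigr => j _.
  by rewrite (ghomD (fr_ghom F j) hm hm') gmorD scalerDl ksgnD.
- move=> i k a m ha hm; rewrite scaler_sumr ksgn_sum; apply: eq_bigr => j _.
  rewrite (ghomZ (fr_ghom F j) ha hm erefl) gmor_ksgn /= gmorM.
  rewrite ksgn_scale ksgnZ !ksgn_ksgn scalerA; apply: eq_ksgn; parity.
Qed.

Lemma frame_ext_dR j : frame_ext (deg j + 1) (dR O (w j)) = x j.
Proof.
rewrite /frame_ext (bigD1 j) //= fr_dual eqxx rmorph1 scale1r ksgn_even; last by parity.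
rewrite big1 ?addr0 // => i ij.
by rewrite fr_dual (negbTE ij) raddf0 scale0r ksgn0.
Qed.

Lemma frame_uniq (X Y : int -> om1 O -> M) s : is_ghom f s X -> is_ghom f s Y ->
  (forall j, X (deg j + 1) (dR O (w j)) = Y (deg j + 1) (dR O (w j))) ->
  forall k om, mgr k om -> X k om = Y k om.
Proof.
move=> hX hY eXY k om hom.
have hp j : gdeg (k - deg j - 1) (fr_phi F j k om).
  by apply: (ghom_deg (fr_ghom F j) hom); ring.
have hw j : mgr (deg j + 1) (dR O (w j)) by apply: dR_deg (fr_deg F j) _.
have hpw j : mgr k (fr_phi F j k om *: dR O (w j)).
  by apply: gmodZ (hp j) (hw j) _; ring.
rewrite (fr_expand F hom) (ghom_sum hX) ?(ghom_sum hY) => [|j _|j _]; try exact: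
  gmod_ksgn.
apply: eq_bigr => j _; rewrite (ghom_ksgn hX) ?(ghom_ksgn hY) //.
have ek : k = k - deg j - 1 + (deg j + 1) by ring.
by rewrite (ghomZ hX (hp j) (hw j) ek) (ghomZ hY (hp j) (hw j) ek) eXY.
Qed.

End Extension.

Section Construction.
Variables (I : finType) (cdeg : I -> int) (X : std_coords A cdeg).
Variables (J : finType) (e : J -> I).
Hypothesis e_inj : injective e.
Hypothesis De : forall j s, S s -> sc_D X (e j) s = 0.
Hypothesis dRe : forall c, c \notin codom e -> dR O (sc_w X c) = 0.

Lemma dR_expansion k a : gdeg k a ->
  dR O a = \sum_j ksgn ((cdeg (e j) + 1) * (k + cdeg (e j)))
                     (sc_D X (e j) a *: dR O (sc_w X (e j))).
Proof.
move=> ha; rewrite (der_expansion X (gderS (dR_der O) scS) ha).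
rewrite (bigID (mem (codom e))) /= [X in _ + X]big1 ?addr0; last first.
  by move=> c hc; rewrite dRe // scaler0 ksgn0.
rewrite (reindex_omap e (fun c => [pick j | e j == c])) /=; last first.
  move=> c /codomP [j ->]; case: pickP => [j' /eqP /e_inj -> //|/(_ j)].
  by rewrite eqxx.
apply: eq_big => [j|j _]; last by rewrite [1 + _]addrC.
rewrite codom_f; case: pickP => [j' /eqP /e_inj ->|/(_ j)]; by rewrite ?eqxx.
Qed.

(** The dual basis consists of the lifts of the partial derivatives. The identity and the expansion
    are both linear endomorphisms of one-forms, so it is enough to compare them on exact forms. The
    selection [e] of coordinates serves the absolute case, where all are kept, and the relative one,
    where only the fibre coordinates are. *)
Lemma coords_frame : frame (cdeg \o e) (sc_w X \o e).
Proof.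
pose phi j := @om1_lift K A S O A (galg_id A) (reg A) (- cdeg (e j)) (sc_D X (e j)).
have hD j : is_gder (galg_id A) (M := reg A) S (- cdeg (e j)) (sc_D X (e j)).
  case: (sc_D_der X (e j)) => h1 h2 _ h4; split=> // s; exact: De.
have hphi j : is_ghom (N := reg A) (galg_id A) (- cdeg (e j) - 1) (phi j) /\
    forall k a, gdeg k a -> phi j (k + 1) (dR O a) = sc_D X (e j) a.
  exact: (@om1_liftP K A S O A (galg_id A) (reg A) _ _ (hD j)).
have hdual j j' : phi j (cdeg (e j') + 1) (dR O (sc_w X (e j'))) = (j == j')%:R.
  by rewrite (hphi j).2 ?sc_D_w ?(inj_eq e_inj) //; apply: sc_w_deg.
exists phi => //=.
- by move=> j; apply: sc_w_deg.
- by move=> j; case: (hphi j).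
move=> k om hom.
have Hid : is_ghom (galg_id A) 0 (fun (_ : int) (m : om1 O) => m).
  by split=> [k' m|//|i k' a m _ _]; rewrite ?addr0 // mul0r ksgn_even.
have hw j : mgr (cdeg (e j) + 1) (dR O (sc_w X (e j))).
  by apply: dR_deg (sc_w_deg X _) _.
have Hsum : is_ghom (galg_id A) 0 (fun k (om : om1 O) =>
    \sum_j ksgn ((cdeg (e j) + 1) * (k + cdeg (e j) + 1))
      (phi j k om *: dR O (sc_w X (e j)))).
  split.
  - move=> k' m hm; apply: gmod_sum => j _; apply/gmod_ksgn.
    have hp := ghom_deg (hphi j).1 hm erefl.
    by apply: gmodZ hp (hw j) _; ring.
  - move=> k' m m' hm hm'; rewrite -big_split /=; apply: eq_bigr => j _.
    by rewrite (ghomD (hphi j).1 hm hm') scalerDl ksgnD.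
  - move=> i k' a m ha hm; rewrite scaler_sumr ksgn_sum; apply: eq_bigr => j _.
    rewrite (ghomZ (hphi j).1 ha hm erefl) /=.
    rewrite ksgn_scale ksgnZ !ksgn_ksgn scalerA; apply: eq_ksgn; parity.
apply: (om1_uniq Hid Hsum _ hom) => i a ha /=.
rewrite [LHS](dR_expansion ha); apply: eq_bigr => j _.
by rewrite (hphi j).2 //; apply: eq_ksgn; parity.
Qed.

End Construction.

End Frames.
(** * Closed two-forms *)

Section Cdga.
Variables (K : fieldType) (C : cdga K).
Implicit Types a b : C.

Lemma cd_ksgn k a : cd (ksgn k a) = ksgn k (cd a).
Proof. exact: (gder_ksgn (cd_der C)). Qed.

(** The sign involves the degree of [a] alone, so [b] can be split into homogeneous components. *)
Lemma cdM i a b : gdeg i a -> cd (a * b) = cd a * b + ksgn i (a * cd b).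
Proof.
move=> ha; have [N [h [hh ->]]] := gdeg_dec b.
rewrite (gder_sum (cd_der C)) mulr_sumr (gder_sum (cd_der C)) !mulr_sumr ksgn_sum.
rewrite -big_split; apply: eq_bigr => k _.
exact: (@md_leibniz K C (regd C) i _ a (h k) ha (hh k)).
Qed.

Lemma cdZ (c : K) a : cd (c *: a) = c *: cd a.
Proof.
rewrite -[c *: a]mulr_algl (cdM _ (gdeg_scalar C c)) (gder_const (cd_der C) (scalar_in
  C c)).
by rewrite mul0r add0r ksgn_even // mulr_algl.
Qed.

Lemma cd_deg0 a : gdeg 0 a -> cd a = 0.
Proof. by move=> ha; apply: (gdeg_npos ltr01); have := gdeg_cd ha; rewrite add0r. Qed.

End Cdga.

Section DGLemmas.
Variable K : fieldType.

Lemma md_sum (A : cdga K) (M : dgmod A) k (I : Type) (s : seq I) (P : pred I)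
    (F : I -> M) : (forall i, P i -> mgr k (F i)) ->
  md k (\sum_(i <- s | P i) F i) = \sum_(i <- s | P i) md k (F i).
Proof.
move=> hF; elim: s => [|i s IH]; first by rewrite !big_nil md0.
rewrite !big_cons; case: ifP => // Pi; rewrite md_add ?IH //; first exact: hF.
exact: gmod_sum.
Qed.

Lemma md_K (A : cdga K) (M : dgmod A) k (c : K) (m : M) : mgr k m ->
  md k (c%:A *: m) = c%:A *: md k m.
Proof.
move=> hm; rewrite -[k in LHS]add0r (md_leibniz (gdeg_scalar A c) hm).
by rewrite (gder_const (cd_der A) (scalar_in A c)) scale0r add0r ksgn_even.
Qed.

(** Reindexing by [k + 1] removes the [k - 1] of [quasi_iso], so that [md k] lands in the right
    degree without rewriting. *)
Lemma quasi_isoS (A : cdga K) (M N : dgmod A) (F : int -> M -> N) :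
  (forall k m n, mgr (k + 1) m -> md (k + 1) m = 0 -> mgr k n ->
     F (k + 1) m = md k n -> exists2 m', mgr k m' & m = md k m') ->
  (forall k n, mgr (k + 1) n -> md (k + 1) n = 0 ->
     exists m n', [/\ mgr (k + 1) m, md (k + 1) m = 0, mgr k n' &
                      n = F (k + 1) m + md k n']) ->
  quasi_iso F.
Proof.
move=> inj surj k; have [k' ->] : exists k', k = k' + 1 by exists (k - 1); ring.
rewrite addrK; split=> [m hm dm [n hn eF]|]; first exact: inj hm dm hn eF.
exact: surj.
Qed.

Lemma bijective_quasi_iso (A : cdga K) (M N : dgmod A) (F : int -> M -> N) :
  is_dgmor F ->
  (forall k m, mgr k m -> F k m = 0 -> m = 0) ->
  (forall k n, mgr k n -> exists2 m, mgr k m & F k m = n) ->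
  quasi_iso F.
Proof.
move=> [hF dF] inj surj; apply: quasi_isoS => [k m n hm dm hn eF|k n hn dn].
  have [m' hm' em'] := surj _ _ hn; exists m' => //.
  have hdm' := md_deg hm'.
  apply/eqP; rewrite -subr_eq0; apply/eqP; apply: (inj (k + 1)).
    exact: mgrB.
  by rewrite (ghomB hF) // dF // em' eF subrr.
have [m hm em] := surj _ _ hn; exists m, 0; split => //.
- by apply: (inj (k + 1 + 1)); [exact: md_deg|rewrite dF // em].
- exact: mgr0.
- by rewrite md0 addr0.
Qed.

Section Forms.
Variables (A : cdga K) (S : A -> Prop) (O : deRham S).
Hypothesis scS : forall s : A, scalars s -> S s.

Lemma wedge_deg i j k (w w' : om1 O) : mgr i w -> mgr j w' -> k = i + j ->
  mgr k (wedge w w').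
Proof.
by move=> hw hw' ->; case: (wedge_symbil O) => h _ _ _; rewrite -[i + j]addr0; apply: h.
Qed.

Lemma wedgeC i j (w w' : om1 O) : mgr i w -> mgr j w' ->
  wedge w' w = ksgn (i * j) (wedge w w').
Proof. by case: (wedge_symbil O) => _ _ _ h; apply: h. Qed.

Lemma wedge0l j (w' : om1 O) : mgr j w' -> wedge 0 w' = 0.
Proof.
case: (wedge_symbil O) => _ h _ _ hw'; apply: (@addrI _ (wedge 0 w')).
by rewrite -(h 0 j) ?addr0 //; apply: mgr0.
Qed.

Lemma wedgeNl i j (w w' : om1 O) : mgr i w -> mgr j w' ->
  wedge (- w) w' = - wedge w w'.
Proof.
case: (wedge_symbil O) => _ h _ _ hw hw'; apply: (@addrI _ (wedge w w')).
by rewrite -(h i j) ?subrr ?(wedge0l hw') //; apply: gmodN.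
Qed.

Lemma wedgeNr i j (w w' : om1 O) : mgr i w -> mgr j w' ->
  wedge w (- w') = - wedge w w'.
Proof.
move=> hw hw'; have hw'N := gmodN hw'.
by rewrite (wedgeC hw'N hw) (wedgeNl hw' hw) (wedgeC hw hw') ksgnN [j * i]mulrC ksgnK.
Qed.

Lemma dR1_0 k : dR1 k (0 : om1 O) = 0.
Proof. by apply: (@addrI _ (dR1 k (0 : om1 O))); rewrite -dR1_add ?addr0 //; apply:
  mgr0. Qed.

Lemma dR1_sum k (I : Type) (s : seq I) (P : pred I) (F : I -> om1 O) :
  (forall i, P i -> mgr k (F i)) ->
  dR1 k (\sum_(i <- s | P i) F i) = \sum_(i <- s | P i) dR1 k (F i).
Proof.
move=> hF; elim: s => [|i s IH]; first by rewrite !big_nil dR1_0.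
rewrite !big_cons; case: ifP => // Pi; rewrite dR1_add ?IH //; first exact: hF.
exact: gmod_sum.
Qed.

Lemma dR1_adR i j k a b : gdeg i a -> gdeg j b -> k = i + j + 1 ->
  dR1 k (a *: dR O b) = wedge (dR O a) (dR O b).
Proof.
move=> ha hb ->; rewrite -addrA (dR1_mul ha (dR_deg O hb erefl)) dR1_dR //.
by rewrite scaler0 ksgn0 addr0.
Qed.

Lemma dR1_K k (c : K) (w : om1 O) : mgr k w -> dR1 k (c%:A *: w) = c%:A *: dR1 k w.
Proof.
move=> hw; rewrite -[k in LHS]add0r (dR1_mul (gdeg_scalar A c) hw).
by rewrite dR_const ?(wedge0l hw) ?add0r ?ksgn_even //; apply/scS/scalar_in.
Qed.

Lemma adR_deg i j k a b : gdeg i a -> gdeg j b -> k = i + j + 1 ->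
  mgr k (a *: dR O b).
Proof. by move=> ha hb ->; apply: gmodZ ha (dR_deg O hb erefl) _; rewrite addrA. Qed.

(* Apply dR1 to the expansion of dR h. *)
Lemma hamiltonian_closed (P : finType) (n : int) (u v : P -> A) (du : P -> int)
    (h : A) :
  odd `|n|%N -> (forall p, gdeg (du p) (u p)) ->
  (forall p, gdeg (n - du p) (v p)) -> gdeg (n + 1) h ->
  dR O h = \sum_p (cd (v p) *: dR O (u p) + cd (u p) *: dR O (v p)) ->
  md (n + 2) (\sum_p wedge (dR O (v p)) (dR O (u p))) = 0.
Proof.
move=> nodd hu hv hh eh.
have hcu p := gdeg_cd (hu p); have hcv p := gdeg_cd (hv p).
have hdu p := dR_deg O (hu p) erefl; have hdv p := dR_deg O (hv p) erefl.
have hdcu p := dR_deg O (hcu p) erefl; have hdcv p := dR_deg O (hcv p) erefl.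
have := dR1_dR O hh; rewrite eh dR1_sum => [e0|p _]; last first.
  by apply: gmodD; [apply: adR_deg (hcv p) (hu p) _|apply: adR_deg (hcu p) (hv p) _];
    ring.
rewrite md_sum => [|p _]; last by apply: wedge_deg (hdv p) (hdu p) _; ring.
apply/eqP; rewrite -oppr_eq0 -sumrN; apply/eqP; rewrite -[RHS]e0.
apply: eq_bigr => p _.
rewrite dR1_add; first last.
- by apply: adR_deg (hcu p) (hv p) _; ring.
- by apply: adR_deg (hcv p) (hu p) _; ring.
rewrite (dR1_adR (hcv p) (hu p)); last by ring.
rewrite (dR1_adR (hcu p) (hv p)); last by ring.
have -> : n + 2 = (n - du p + 1) + (du p + 1) by ring.
rewrite (wedge_d (hdv p) (hdu p)) !dR_d // (wedgeNl (hdcv p) (hdu p)).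
rewrite (wedgeNr (hdv p) (hdcu p)) ksgnN opprD !opprK; congr (_ + _).
(* As [n] is odd, the total exponent is congruent to [du p * (du p + 1)], hence even. *)
rewrite (wedgeC (hdcu p) (hdv p)) ksgn_ksgn ksgn_even //.
by move: nodd; parity.
Qed.

End Forms.

End DGLemmas.
(** * Tangent complexes and contraction *)

Section TangentComplex.
Variable K : fieldType.
Variables (A : cdga K) (S : A -> Prop) (O : deRham S).

Section Coordinates.
Variables (J : finType) (deg : J -> int) (w : J -> A) (F : frame O deg w).

Lemma frame_dR_deg j : mgr (deg j + 1) (dR O (w j)).
Proof. exact: dR_deg (fr_deg F j) erefl. Qed.

Lemma frame_free k (c : J -> A) : (forall j, gdeg (k - deg j - 1) (c j)) ->
  \sum_j c j *: dR O (w j) = 0 -> forall j, c j = 0.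
Proof.
move=> hc e0 j; have hF := fr_ghom F j.
have hcw i : mgr k (c i *: dR O (w i)).
  by apply: gmodZ (hc i) (frame_dR_deg i) _; ring.
have := ghom0 hF k; rewrite -e0 (ghom_sum hF) // (bigD1 j) //= big1 ?addr0.
  rewrite (ghomZ hF (hc j) (frame_dR_deg j)); last by ring.
  rewrite fr_dual eqxx => /(congr1 (ksgn ((- deg j - 1) * (k - deg j - 1)))).
  by rewrite ksgnK ksgn0 => <-; rewrite [RHS]mulr1.
move=> i ij; rewrite (ghomZ hF (hc i) (frame_dR_deg i)); last by ring.
by rewrite fr_dual eq_sym (negbTE ij) scaler0 ksgn0.
Qed.

Variables (C : cdga K) (f : cdgamor A C).
Implicit Types X Y : tangent O f.

Lemma tangent_ghom k X : mgr k X -> is_ghom (N := reg C) f (k - 1) X.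
Proof. by case. Qed.

Lemma tangent_eq k X Y : mgr k X -> mgr k Y ->
  (forall j, X (deg j + 1) (dR O (w j)) = Y (deg j + 1) (dR O (w j))) -> X = Y.
Proof.
move=> hX hY eXY; apply/funext => i; apply/funext => om.
have [hom|nhom] := pselect (mgr i om).
  exact: (frame_uniq F (tangent_ghom hX) (tangent_ghom hY) eXY hom).
by case: hX => _ -> //; case: hY => _ ->.
Qed.

Lemma tangent_ext k (x : J -> C) : (forall j, gdeg (deg j + k) (x j)) ->
  exists2 X : tangent O f, mgr k X &
    forall j, X (deg j + 1) (dR O (w j)) = x j.
Proof.
move=> hx.
have hx' j : mgr (deg j + 1 + (k - 1)) (x j : reg C).
  by rewrite /= addrACA subrr addr0.
have [E1 E2 E3] := frame_ext_ghom F f hx'.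
(* [hom_gr] requires the value 0 off the component of degree [i]. *)
exists (fun i om => if `[< mgr i om >] then frame_ext F (M := reg C) f (k - 1) x i om
  else 0).
  split; last by move=> i om hom; case: asboolP.
  split=> [i m hm|i m m' hm hm'|i j a m ha hm]; rewrite !asboolT //; first exact: E1.
  - exact: E2.
  - exact: gmodD.
  - exact: E3.
  - exact: mgrZ.
by move=> j; rewrite asboolT ?frame_ext_dR //; apply: frame_dR_deg.
Qed.

Lemma tangent_deg k X i j om : mgr k X -> mgr i om -> j = i + k - 1 ->
  gdeg j (X i om).
Proof.
by move=> hX hom ->; apply: (ghom_deg (tangent_ghom hX) hom); rewrite addrA.
Qed.

Lemma tangent_mdE k X i om : mgr i om ->
  md k X i om = cd (X i om) - ksgn (k - 1) (X (i + 1) (md i om)).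
Proof. by move=> hom; rewrite /= /hom_d asboolT. Qed.

End Coordinates.

(** * Contraction with a closed two-form in Darboux shape *)

Section Symplectic.
Implicit Type X : tangent O (cdga_id A).

Let ctr (k : int) X (i j : int) (w w' : om1 O) : om1 O :=
  X i w *: w' + ksgn (i * j) (X j w' *: w).

Let ctr_deg k X i j w w' l : mgr k X -> mgr i w -> mgr j w' -> l = i + j + (k - 1) ->
  mgr l (ctr k X i j w w').
Proof.
move=> hX hw hw' ->; apply: gmodD; last apply: gmod_ksgn.
  by apply: gmodZ (tangent_deg hX hw erefl) hw' _; ring.
by apply: gmodZ (tangent_deg hX hw' erefl) hw _; ring.
Qed.

Let ctr_symbil k X : mgr k X ->
  is_symbil (galg_id A) (M := om1 O) (N := om1 O) (k - 1) (ctr k X).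
Proof.
move=> hX; have hF := tangent_ghom hX; split=> [i j m m' hm hm'|i j m1 m2 m' h1 h2 h'|t
  i j a m m' ha hm hm'|i j m m' hm hm'].
- exact: ctr_deg hX hm hm' erefl.
- by rewrite /ctr (ghomD hF h1 h2) scalerDl scalerDr ksgnD addrACA.
- rewrite /ctr (ghomZ hF ha hm erefl) /= ksgn_scale scalerDr ksgnD ksgnZ !ksgn_ksgn.
  congr (_ + _); first by rewrite scalerA.
  rewrite !scalerA (gcomm (tangent_deg hX hm' erefl) ha) ksgn_scale ksgn_ksgn.
  by apply: eq_ksgn; parity.
- rewrite /ctr ksgnD ksgn_ksgn addrC [j * i]mulrC; congr (_ + _).
  by rewrite ksgn_even //; parity.
Qed.

(** This is d(i_X omega) = i_(dX) omega + (-1)^(k-1) i_X(d omega) on a product: the terms X(dw) and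
    X(dw') coming from dX cancel those of the last bracket. *)
Let ctr_md k X i j w w' : mgr k X -> mgr i w -> mgr j w' ->
  md (i + j + (k - 1)) (ctr k X i j w w') =
  ctr (k + 1) (md k X) i j w w' +
  ksgn (k - 1) (ctr k X (i + 1) j (md i w) w' +
                ksgn i (ctr k X i (j + 1) w (md j w'))).
Proof.
move=> hX hw hw'.
have hXw := tangent_deg hX hw erefl; have hXw' := tangent_deg hX hw' erefl.
rewrite md_add; last 2 first.
- by apply: gmodZ hXw hw' _; ring.
- by apply/gmod_ksgn/(gmodZ hXw' hw); ring.
rewrite md_ksgn; last by apply: gmodZ hXw' hw _; ring.
have -> : i + j + (k - 1) = i + k - 1 + j by ring.
rewrite (md_leibniz hXw hw').
have -> : i + k - 1 + j = j + k - 1 + i by ring.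
rewrite (md_leibniz hXw' hw) /ctr !tangent_mdE // !scalerBl !ksgnD !ksgnN.
rewrite !ksgn_scale !ksgn_ksgn.
set t1 := cd _ *: w'; set t3 := ksgn _ (cd _ *: w).
set t2 := ksgn _ (X i w *: _); set t4 := ksgn _ (X j w' *: _).
set s5 := ksgn _ (X (i + 1) _ *: w').
set s6 := ksgn (i * j + _) (X (j + 1) _ *: w).
have -> : ksgn (k - 1 + (i + 1) * j) (X j w' *: md i w) = t4.
  by apply: eq_ksgn; parity.
have -> : ksgn (k - 1 + i) (X i w *: md j w') = t2 by apply: eq_ksgn; parity.
have -> : ksgn (k - 1 + i + i * (j + 1)) (X (j + 1) (md j w') *: w) = s6.
  by apply: eq_ksgn; parity.
by rewrite [RHS](AC ((2*2)*(2*2)) (1*7*(3*6)*(5*2)*(8*4))%AC) /= !subrr !addr0.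
Qed.

Variables (P : finType) (n : int) (u v : P -> A) (du : P -> int).
Hypothesis hu : forall p, gdeg (du p) (u p).
Hypothesis hv : forall p, gdeg (n - du p) (v p).
Let gamma : om2 O := \sum_p wedge (dR O (v p)) (dR O (u p)).
Hypothesis md_gamma : md (n + 2) gamma = 0.

Let hdu p : mgr (du p + 1) (dR O (u p)) := dR_deg O (hu p) erefl.
Let hdv p : mgr (n - du p + 1) (dR O (v p)) := dR_deg O (hv p) erefl.

Let contractionE k X : mgr k X -> contraction n gamma k X =
  \sum_p ctr k X (n - du p + 1) (du p + 1) (dR O (v p)) (dR O (u p)).
Proof.
move=> hX; have [hL eL] := om2_liftP (ctr_symbil hX).
rewrite /contraction -/(ctr k X) /gamma (ghom_sum hL) => [|p _]; last first.
  by apply: wedge_deg (hdv p) (hdu p) _; ring.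
apply: eq_bigr => p _; rewrite -eL //; congr om2_lift; ring.
Qed.

Lemma contraction_dgmor :
  is_dgmor (M := tangent O (cdga_id A)) (N := shift (n + 1) (om1 O))
    (contraction n gamma).
Proof.
have hc k X p : mgr k X ->
    mgr (k + (n + 1)) (ctr k X (n - du p + 1) (du p + 1) (dR O (v p)) (dR O (u p))).
  by move=> hX; apply: ctr_deg hX (hdv p) (hdu p) _; ring.
split; first split.
- by move=> k X hX; rewrite (contractionE hX) addr0; apply: gmod_sum => p _; apply: hc.
- move=> k X Y hX hY /=; rewrite !contractionE //; last exact: mgrD.
  rewrite -big_split /=.
  by apply: eq_bigr => p _; rewrite /ctr !scalerDl ksgnD addrACA.
- move=> i k a X ha hX /=; rewrite !contractionE //; last exact: mgrZ.
  rewrite mul0r ksgn_even // scaler_sumr; apply: eq_bigr => p _.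
  by rewrite /ctr scalerDr ksgnZ !scalerA.
move=> k X hX; have hdX := md_deg hX.
rewrite !contractionE //= md_sum => [|p _]; last exact: hc.
have [hL eL] := om2_liftP (ctr_symbil hX).
(* Adding i_X(d gamma) = 0, expanded as a sum over [p], makes [ctr_md] applicable to each
   summand. *)
have := ghom0 hL (n + 2 + 1); rewrite -md_gamma md_sum => [|p _]; last first.
  by apply: wedge_deg (hdv p) (hdu p) _; ring.
rewrite (ghom_sum hL) => [e0|p _]; last first.
  by apply: md_deg; apply: wedge_deg (hdv p) (hdu p) _; ring.
move: e0 => /(congr1 (ksgn (k - 1))); rewrite ksgn0 ksgn_sum => e0.
rewrite -[LHS]addr0 -[X in _ + X]e0 -big_split /=.
apply: eq_bigr => p _.
have -> : k + (n + 1) = n - du p + 1 + (du p + 1) + (k - 1) by ring.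
rewrite ctr_md //; congr (_ + ksgn _ _).
have hv' := md_deg (hdv p); have hu' := md_deg (hdu p).
have -> : n + 2 = (n - du p + 1) + (du p + 1) by ring.
rewrite wedge_d // (ghomD hL); last 2 first.
- by apply: wedge_deg hv' (hdu p) _; ring.
- by apply/gmod_ksgn/(wedge_deg (hdv p) hu'); ring.
rewrite (ghom_ksgn hL); last by apply: wedge_deg (hdv p) hu' _; ring.
have eL' i j l w w' : mgr i w -> mgr j w' -> l = i + j ->
    om2_lift (galg_id A) (k - 1) (ctr k X) l (wedge w w') = ctr k X i j w w'.
  by move=> hw hw' ->; apply: eL.
by congr (_ + ksgn _ _); apply: eL' => //; ring.
Qed.

Hypothesis F : frame O (fun j : P + P => match j with inl p => du p | inr p => n - du p
  end)
  (fun j => match j with inl p => u p | inr p => v p end).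

Lemma contraction_equivalence :
  is_equivalence (M := tangent O (cdga_id A)) (N := shift (n + 1) (om1 O))
    (contraction n gamma).
Proof.
split; first exact: contraction_dgmor.
apply: bijective_quasi_iso; first exact: contraction_dgmor.
- move=> k X hX; rewrite (contractionE hX) => e0.
  apply: (tangent_eq F hX (mgr0 _ k)).
  (* These are the coefficients of the contraction in the frame: [X] on [dR v] multiplies [dR u],
     and [X] on [dR u] multiplies [dR v]. *)
  pose c (j : P + P) := match j with inl p => X (n - du p + 1) (dR O (v p))
    | inr p => ksgn ((n - du p + 1) * (du p + 1)) (X (du p + 1) (dR O (u p))) end.
  have hc : forall j, c j = 0.
    apply: (frame_free F (k := k + n + 1)) => [[p|p]|].
    - by apply: tangent_deg hX (hdv p) _; ring.
    - by apply/(gmod_ksgn (M := reg A))/(tangent_deg hX (hdu p)); ring.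
    rewrite big_sumType /= -big_split -[RHS]e0; apply: eq_bigr => p _.
    by rewrite /ctr ksgn_scale.
  case=> p /=; last exact: (hc (inl p)).
  by apply: (can_inj (ksgnK _)); rewrite ksgn0; apply: (hc (inr p)).
move=> k om hom; have ht j := ghom_deg (fr_ghom F j) hom erefl.
pose deg (j : P + P) := match j with inl p => du p | inr p => n - du p end.
pose t j := ksgn ((deg j + 1) * (k + (n + 1) + deg j + 1)) (fr_phi F j (k + (n + 1))
  om).
(* The preimage takes on each basis form the coefficient of the conjugate one in [om], corrected by
   the sign that the contraction introduces. *)
pose x (j : P + P) := match j with inl p => ksgn ((n - du p + 1) * (du p + 1)) (t (inr
  p))
    | inr p => t (inl p) end.
have [j|X hX eX] := tangent_ext F (cdga_id A) (k := k) (x := x).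
  case: j => p /=; do ?[apply: (gmod_ksgn (M := reg A))].
    by have := ht (inr p); congr gdeg; ring.
  by have := ht (inl p); congr gdeg; ring.
exists X => //; rewrite (contractionE hX) [RHS](fr_expand F hom).
rewrite big_sumType /= -big_split; apply: eq_bigr => p _.
rewrite /ctr (eX (inl p)) (eX (inr p)) /= /t !ksgn_scale !ksgn_ksgn.
by congr (_ + _); apply: eq_ksgn; parity.
Qed.

End Symplectic.

End TangentComplex.
(** * Pairings *)

Section Pairing.
Variable K : fieldType.
Variables (A : cdga K) (S : A -> Prop) (O : deRham S).
Hypothesis scS : forall s : A, scalars s -> S s.
Variables (C : cdga K) (f : cdgamor A C).
Implicit Types X Y : tangent O f.

Definition pairing_form (k l : int) X Y (i j : int) (w w' : om1 O) : C :=
  ksgn ((l - 1) * (i + (k - 1))) ((X i w : C) * (Y j w' : C))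
  + ksgn ((k - 1) * i) ((Y i w : C) * (X j w' : C)).

Lemma pairing_form_deg k l X Y i j w w' t : mgr k X -> mgr l Y ->
  mgr i w -> mgr j w' -> t = i + j + (k - 1 + (l - 1)) ->
  gdeg t (pairing_form k l X Y i j w w').
Proof.
move=> hX hY hw hw' ->; apply: (@gmodD _ _ (reg C)); apply: (@gmod_ksgn _ _ (reg C)).
  by apply: gdegM_eq (tangent_deg hX hw erefl) (tangent_deg hY hw' erefl) _; ring.
by apply: gdegM_eq (tangent_deg hY hw erefl) (tangent_deg hX hw' erefl) _; ring.
Qed.

Lemma pairing_form_symbil k l X Y : mgr k X -> mgr l Y ->
  is_symbil f (N := reg C) (k - 1 + (l - 1)) (pairing_form k l X Y).
Proof.
move=> hX hY; have hFX := tangent_ghom hX; have hFY := tangent_ghom hY.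
split=> [i j m m' hm hm'|i j m1 m2 m' h1 h2 h'|t i j a m m' ha hm hm'|i j m m' hm hm'].
- exact: pairing_form_deg hX hY hm hm' erefl.
- rewrite /pairing_form (ghomD hFX h1 h2) (ghomD hFY h1 h2) !mulrDl !ksgnD.
  by rewrite addrACA.
- rewrite /pairing_form (ghomZ hFX ha hm erefl) (ghomZ hFY ha hm erefl) /=.
  rewrite scalerDr ksgnD !ksgn_mull !ksgnZ !ksgn_ksgn.
  by congr (_ + _); rewrite -mulrA; apply: eq_ksgn; parity.
- rewrite /pairing_form ksgnD !ksgn_ksgn addrC.
  rewrite (gcomm (tangent_deg hX hm erefl) (tangent_deg hY hm' erefl)).
  rewrite (gcomm (tangent_deg hY hm erefl) (tangent_deg hX hm' erefl)).
  by rewrite !ksgn_ksgn; congr (_ + _); apply: eq_ksgn; parity.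
Qed.

(** The analogue of [ctr_md] for two successive contractions; the values of X and Y on dw and dw'
    cancel in the same way. *)
Lemma pairing_form_md k l X Y i j w w' : mgr k X -> mgr l Y ->
  mgr i w -> mgr j w' ->
  cd (pairing_form k l X Y i j w w') =
  pairing_form k (l + 1) X (md l Y) i j w w'
  + ksgn (l - 1) (pairing_form (k + 1) l (md k X) Y i j w w')
  + ksgn (k - 1 + (l - 1)) (pairing_form k l X Y (i + 1) j (md i w) w' +
                ksgn i (pairing_form k l X Y i (j + 1) w (md j w'))).
Proof.
move=> hX hY hw hw'; rewrite /pairing_form !tangent_mdE //.
rewrite (gderD (cd_der C)).
rewrite !cd_ksgn (cdM _ (tangent_deg hX hw erefl)) (cdM _ (tangent_deg hY hw erefl)).
rewrite !(mulrBl, mulrBr) !(ksgnD, ksgnN) !ksgn_mulr !ksgn_mull !ksgn_ksgn.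
set t1 := ksgn _ (cd (X i w) * _); set t2 := ksgn _ (X i w * cd _).
set t3 := ksgn _ (cd (Y i w) * _); set t4 := ksgn _ (Y i w * cd _).
set s1 := ksgn _ (X i w * Y (j + 1) _).
set s2 := ksgn _ (Y (i + 1) _ * X j w').
set s3 := ksgn _ (X (i + 1) _ * Y j w').
set s4 := ksgn _ (Y i w * X (j + 1) _).
rewrite (_ : ksgn _ (X i w * cd (Y j w')) = t2); last by apply: eq_ksgn; parity.
rewrite (_ : ksgn _ (cd (X i w) * Y j w') = t1); last by apply: eq_ksgn; parity.
rewrite (_ : ksgn _ (Y i w * cd (X j w')) = t4); last by apply: eq_ksgn; parity.
rewrite (_ : ksgn _ (X (i + 1) (md i w) * Y j w') = s3); last by apply: eq_ksgn; parity.
rewrite (_ : ksgn _ (Y (i + 1) (md i w) * X j w') = s2); last by apply: eq_ksgn; parity.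
rewrite (_ : ksgn _ (X i w * Y (j + 1) (md j w')) = s1); last by apply: eq_ksgn; parity.
rewrite (_ : ksgn _ (Y i w * X (j + 1) (md j w')) = s4); last by apply: eq_ksgn; parity.
rewrite [RHS](AC (((2*2)*(2*2))*((1*1)*(1*1)))
  ((5*1*(3*7))*(6*9)*(8*12)*(2*11)*(4*10))%AC) /=.
by rewrite !addNr !addr0.
Qed.

End Pairing.

Section PairingSum.
Variable K : fieldType.
Variables (A : cdga K) (S : A -> Prop) (O : deRham S).
Variables (C : cdga K) (f : cdgamor A C).
Implicit Types X Y : tangent O f.
Variables (P : finType) (n : int) (u v : P -> A) (du : P -> int) (kap : P -> K).
Hypothesis hu : forall p, gdeg (du p) (u p).
Hypothesis hv : forall p, gdeg (n - du p) (v p).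
Let om : om2 O := \sum_p (kap p)%:A *: wedge (dR O (v p)) (dR O (u p)).

Let hdu p : mgr (du p + 1) (dR O (u p)) := dR_deg O (hu p) erefl.
Let hdv p : mgr (n - du p + 1) (dR O (v p)) := dR_deg O (hv p) erefl.
Let hw p : mgr (n + 2) (wedge (dR O (v p)) (dR O (u p))).
Proof. by apply: wedge_deg (hdv p) (hdu p) _; ring. Qed.

Lemma pairingE k l X Y : mgr k X -> mgr l Y ->
  pairing n om k l X Y = \sum_p kap p *: pairing_form k l X Y
    (n - du p + 1) (du p + 1) (dR O (v p)) (dR O (u p)).
Proof.
move=> hX hY; have [hL eL] := om2_liftP (pairing_form_symbil hX hY).
rewrite /pairing (ghom_sum hL) => [|p _]; last exact: gmodK.
apply: eq_bigr => p _; rewrite (ghomK hL) //.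
have -> : n + 2 = (n - du p + 1) + (du p + 1) by ring.
by rewrite eL //; apply: mulr_algl.
Qed.

Lemma pairing_deg k l X Y : mgr k X -> mgr l Y ->
  gdeg (k + l + n) (pairing n om k l X Y).
Proof.
move=> hX hY; rewrite pairingE //; apply: (@gmod_sum _ _ (reg C)) => p _.
by apply: gdegZ; apply: pairing_form_deg hX hY (hdv p) (hdu p) _; ring.
Qed.

Lemma pairingDl k l X X' Y : mgr k X -> mgr k X' -> mgr l Y ->
  pairing n om k l (X + X') Y = pairing n om k l X Y + pairing n om k l X' Y.
Proof.
move=> hX hX' hY; rewrite !pairingE //; last exact: mgrD.
rewrite -big_split; apply: eq_bigr => p _ /=.
by rewrite -scalerDr /pairing_form !(mulrDl, mulrDr) !ksgnD addrACA.
Qed.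

Lemma pairingDr k l X Y Y' : mgr k X -> mgr l Y -> mgr l Y' ->
  pairing n om k l X (Y + Y') = pairing n om k l X Y + pairing n om k l X Y'.
Proof.
move=> hX hY hY'; rewrite !pairingE //; last exact: mgrD.
rewrite -big_split; apply: eq_bigr => p _ /=.
by rewrite -scalerDr /pairing_form !(mulrDl, mulrDr) !ksgnD addrACA.
Qed.

Lemma pairingZl t k l a X Y : gdeg t a -> mgr k X -> mgr l Y ->
  pairing n om (t + k) l (a *: X) Y = ksgn (t * (l - 1)) (a * pairing n om k l X Y).
Proof.
move=> ha hX hY; rewrite !pairingE //; last exact: mgrZ.
rewrite mulr_sumr ksgn_sum; apply: eq_bigr => p _ /=.
rewrite -scalerAr -ksgnZ; congr (_ *: _).
rewrite /pairing_form (mulrDr (a : C)) !ksgn_mulr ksgnD !ksgn_ksgn !mulrA.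
rewrite (gcomm (tangent_deg hY (hdv p) erefl) ha) ksgn_mull ksgn_ksgn.
by congr (_ + _); apply: eq_ksgn; parity.
Qed.

Lemma pairingZr t k l a X Y : gdeg t a -> mgr k X -> mgr l Y ->
  pairing n om k (t + l) X (a *: Y) = a * pairing n om k l X Y.
Proof.
move=> ha hX hY; rewrite !pairingE //; last exact: mgrZ.
rewrite mulr_sumr; apply: eq_bigr => p _ /=.
rewrite -scalerAr; congr (_ *: _).
rewrite /pairing_form (mulrDr (a : C)) !ksgn_mulr !mulrA.
rewrite (gcomm (tangent_deg hX (hdv p) erefl) ha) ksgn_mull ksgn_ksgn.
by congr (_ + _); apply: eq_ksgn; parity.
Qed.

Hypothesis md_om : md (n + 2) om = 0.

(** The contribution of d omega to [pairing_form_md] disappears only after summation over [p], so it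
    is added as a vanishing sum before comparing summands. *)
Lemma pairing_md k l X Y : mgr k X -> mgr l Y ->
  cd (pairing n om k l X Y) = pairing n om k (l + 1) X (md l Y)
    + ksgn (l - 1) (pairing n om (k + 1) l (md k X) Y).
Proof.
move=> hX hY; have hdX := md_deg hX; have hdY := md_deg hY.
rewrite !pairingE //.
have [hL eL] := om2_liftP (pairing_form_symbil hX hY).
have eL' i j t w w' : mgr i w -> mgr j w' -> t = i + j ->
    om2_lift f (M := reg C) (k - 1 + (l - 1)) (pairing_form k l X Y) t (wedge w w') =
    pairing_form k l X Y i j w w'.
  by move=> h h' ->; apply: eL.
have hkw p : mgr (n + 2) ((kap p)%:A *: wedge (dR O (v p)) (dR O (u p))).
  exact: gmodK.
have e0 := ghom0 hL (n + 2 + 1).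
rewrite -md_om md_sum // (ghom_sum hL) in e0; last by move=> p _; exact: md_deg.
move: e0 => /(congr1 (ksgn (k - 1 + (l - 1)))); rewrite ksgn0 ksgn_sum => e0.
rewrite (gder_sum (cd_der C)) -[RHS]addr0 -[X in _ + X]e0 ksgn_sum -!big_split.
apply: eq_bigr => p _ /=.
rewrite md_K // (ghomK hL) //; last exact: md_deg.
have hv' := md_deg (hdv p); have hu' := md_deg (hdu p).
have en : n + 2 = (n - du p + 1) + (du p + 1) by ring.
have em : md (n + 2) (wedge (dR O (v p)) (dR O (u p))) =
    wedge (md (n - du p + 1) (dR O (v p))) (dR O (u p)) +
    ksgn (n - du p + 1) (wedge (dR O (v p)) (md (du p + 1) (dR O (u p)))).
  by rewrite en wedge_d.
have h1 : mgr (n + 2 + 1) (wedge (md (n - du p + 1) (dR O (v p))) (dR O (u p))).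
  by apply: wedge_deg hv' (hdu p) _; ring.
have h2 : mgr (n + 2 + 1) (wedge (dR O (v p)) (md (du p + 1) (dR O (u p)))).
  by apply: wedge_deg (hdv p) hu' _; ring.
rewrite em (ghomD hL) //; last exact: gmod_ksgn.
rewrite (ghom_ksgn hL) // (eL' _ _ _ _ _ hv' (hdu p)) ?(eL' _ _ _ _ _ (hdv p) hu'); try
  ring.
rewrite cdZ pairing_form_md //.
rewrite [LHS]scalerDr [X in X + _]scalerDr; congr (_ + _ + _); rewrite ksgnZ //.
by congr ksgn; symmetry; apply: mulr_algl.
Qed.

End PairingSum.

(** * Nondegeneracy on the contact distribution *)

Section Contact.
Variable K : fieldType.
Variables (A : cdga K) (S : A -> Prop) (O : deRham S).
Hypothesis scS : forall s : A, scalars s -> S s.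
Variables (P : finType) (n : int) (u v : P -> A) (z : A) (du : P -> int).
Variables (kap : P -> K) (kz : K).
Hypothesis kap_neq0 : forall p, kap p != 0.
Hypothesis kz_neq0 : kz != 0.
Hypothesis du_le0 : forall p, du p <= 0.
Hypothesis n_le_du : forall p, n <= du p.

Let J : finType := (P + P + unit)%type.
Let deg (j : J) : int :=
  match j with inl (inl p) => du p | inl (inr p) => n - du p | inr _ => n end.
Let w (j : J) : A :=
  match j with inl (inl p) => u p | inl (inr p) => v p | inr _ => z end.
Variable F : frame O deg w.

Let hu p : gdeg (du p) (u p) := fr_deg F (inl (inl p)).
Let hv p : gdeg (n - du p) (v p) := fr_deg F (inl (inr p)).
Let hz : gdeg n z := fr_deg F (inr tt).
Let hdu p : mgr (du p + 1) (dR O (u p)) := dR_deg O (hu p) erefl.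
Let hdv p : mgr (n - du p + 1) (dR O (v p)) := dR_deg O (hv p) erefl.
Let hdz : mgr (n + 1) (dR O z) := dR_deg O hz erefl.

Definition darboux_form : om1 O :=
  \sum_p (kap p)%:A *: (v p *: dR O (u p)) + kz%:A *: dR O z.

Definition darboux_2form : om2 O :=
  \sum_p (kap p)%:A *: wedge (dR O (v p)) (dR O (u p)).

Let hvdu p : mgr (n + 1) (v p *: dR O (u p)).
Proof. by apply: gmodZ (hv p) (hdu p) _; ring. Qed.

Let hkvdu p : mgr (n + 1) ((kap p)%:A *: (v p *: dR O (u p))).
Proof. exact: gmodK. Qed.

Let hkdz : mgr (n + 1) (kz%:A *: dR O z).
Proof. exact: gmodK. Qed.

Lemma darboux_form_deg : mgr (n + 1) darboux_form.
Proof. by apply: gmodD => //; apply: gmod_sum. Qed.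

Lemma dR1_darboux_form : dR1 (n + 1) darboux_form = darboux_2form.
Proof.
rewrite /darboux_form dR1_add //; last exact: gmod_sum.
rewrite dR1_sum // (dR1_K scS) // dR1_dR // scaler0 addr0; apply: eq_bigr => p _.
rewrite (dR1_K scS) //; congr (_ *: _).
by apply: dR1_adR (hv p) (hu p) _; ring.
Qed.

Section Coefficients.
Variables (C : cdga K) (f : cdgamor A C).
Local Notation T := (tangent O f).
Local Notation om := darboux_2form.
Implicit Types X Y : T.

Lemma tangent_darboux_form k X : mgr k X -> X (n + 1) darboux_form =
  \sum_p kap p *: ksgn ((k - 1) * (n - du p)) (f (v p) * X (du p + 1) (dR O (u p)))
  + kz *: (X (n + 1) (dR O z) : C).
Proof.
move=> hX; have hF := tangent_ghom hX.
rewrite /darboux_form (ghomD hF) //; last exact: gmod_sum.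
rewrite (ghom_sum hF) // (ghomK hF) //; congr (_ + _); last by rewrite -[RHS]mulr_algl.
apply: eq_bigr => p _; rewrite (ghomK hF) // (ghomZ hF (hv p) (hdu p)); last by ring.
by rewrite -[RHS]mulr_algl.
Qed.

Lemma tangent_sumE (I : Type) (s : seq I) (G : I -> T) i (m : om1 O) :
  (\sum_(j <- s) G j) i m = \sum_(j <- s) G j i m.
Proof. by elim: s => [|j s IH]; rewrite ?big_nil // !big_cons -IH. Qed.

Lemma coord_vector_ex j : {Y : T | mgr (- deg j) Y /\
  forall j', Y (deg j' + 1) (dR O (w j')) = (j == j')%:R}.
Proof.
apply: cid; have [j'|Y hY eY] := tangent_ext F f (k := - deg j) (x := fun j' => (j ==
  j')%:R).
  case: eqP => [<-|_]; last exact: gdeg0.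
  by rewrite subrr; apply: gdeg1.
by exists Y.
Qed.

(** The coordinate vector field of [w j], with coefficients in C. *)
Definition coord_vector j : T := sval (coord_vector_ex j).
Local Notation D := coord_vector.

Lemma coord_vector_deg j : mgr (- deg j) (D j).
Proof. exact: (svalP (coord_vector_ex j)).1. Qed.

Lemma coord_vectorE j j' : D j (deg j' + 1) (dR O (w j')) = (j == j')%:R.
Proof. exact: (svalP (coord_vector_ex j)).2. Qed.

Let hDY k j Y : mgr k Y -> mgr k (Y (deg j + 1) (dR O (w j)) *: D j).
Proof.
move=> hY; have h := tangent_deg hY (frame_dR_deg F j) erefl.
by apply: gmodZ h (coord_vector_deg j) _; ring.
Qed.

Lemma tangent_expand k Y : mgr k Y ->
  Y = \sum_j Y (deg j + 1) (dR O (w j)) *: D j.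
Proof.
move=> hY; have hS : mgr k (\sum_j Y (deg j + 1) (dR O (w j)) *: D j).
  by apply: gmod_sum => j _; apply: hDY.
apply: (tangent_eq F hY hS) => j.
have ev i : (Y (deg i + 1) (dR O (w i)) *: D i) (deg j + 1) (dR O (w j)) =
    (Y (deg i + 1) (dR O (w i)) : C) * (i == j)%:R by rewrite -coord_vectorE.
rewrite tangent_sumE (bigD1 j) //= ev eqxx mulr1 big1 ?addr0 // => i ij.
by rewrite ev (negbTE ij) mulr0.
Qed.

Lemma tangent_ghom_eq r (phi psi : int -> T -> C) :
  is_ghom (galg_id C) (N := reg C) r phi -> is_ghom (galg_id C) (N := reg C) r psi ->
  (forall j, phi (- deg j) (D j) = psi (- deg j) (D j)) ->
  forall k Y, mgr k Y -> phi k Y = psi k Y.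
Proof.
move=> hphi hpsi e k Y hY; rewrite (tangent_expand hY).
rewrite (ghom_sum hphi) ?(ghom_sum hpsi) => [|j _|j _]; try exact: hDY.
have hc j := tangent_deg hY (frame_dR_deg F j) erefl.
apply: eq_bigr => j _.
rewrite (ghomZ hphi (hc j) (coord_vector_deg j)) ?(ghomZ hpsi (hc j) (coord_vector_deg
  j)).
- by rewrite e.
- ring.
- ring.
Qed.

(** [pairing] is linear in [Y] without sign; the exponent [k + (n + k) * l] supplies the Koszul sign
    of a map of degree [k + n]. *)
Lemma pairing_ghom k X : mgr k X ->
  is_ghom (galg_id C) (M := T) (N := reg C) (k + n)
    (fun l Y => ksgn (k + (n + k) * l) (pairing n om k l X Y)).
Proof.
move=> hX; split=> [l Y hY|l Y Y' hY hY'|i l a Y ha hY].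
- by apply: gmod_ksgn; have := pairing_deg kap hu hv hX hY; congr gdeg; ring.
- by rewrite (pairingDr kap hu hv hX hY hY') ksgnD.
- rewrite (pairingZr kap hu hv ha hX hY) /=.
  rewrite [a *: ksgn _ _]ksgnZ ksgn_ksgn; apply: eq_ksgn; parity.
Qed.

Let pairing_D k X j : mgr k X -> pairing n om k (- deg j) X (D j) =
  \sum_p kap p *:
    (ksgn ((- deg j - 1) * (n - du p + 1 + (k - 1)))
       ((X (n - du p + 1) (dR O (v p)) : C) * (j == inl (inl p))%:R)
     + ksgn ((k - 1) * (n - du p + 1))
         ((j == inl (inr p))%:R * (X (du p + 1) (dR O (u p)) : C))).
Proof.
move=> hX; rewrite (pairingE kap hu hv hX (coord_vector_deg j)).
apply: eq_bigr => p _; rewrite /pairing_form.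
by rewrite -(coord_vectorE j (inl (inl p))) -(coord_vectorE j (inl (inr p))).
Qed.

Lemma pairing_coord_u k X p : mgr k X ->
  pairing n om k (- du p) X (D (inl (inl p))) =
  kap p *: ksgn ((- du p - 1) * (n - du p + 1 + (k - 1)))
    (X (n - du p + 1) (dR O (v p)) : C).
Proof.
move=> hX; rewrite (pairing_D (inl (inl p)) hX) (bigD1 p) //= eqxx mulr1 mul0r.
rewrite ksgn0 addr0 big1 ?addr0 // => p' pp'.
have -> : (inl (inl p) == inl (inl p') :> J) = false by rewrite eq_sym in pp';
  apply/negbTE.
by rewrite mulr0 mul0r !ksgn0 addr0 scaler0.
Qed.

Lemma pairing_coord_v k X p : mgr k X ->
  pairing n om k (- (n - du p)) X (D (inl (inr p))) =
  kap p *: ksgn ((k - 1) * (n - du p + 1)) (X (du p + 1) (dR O (u p)) : C).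
Proof.
move=> hX; rewrite (pairing_D (inl (inr p)) hX) (bigD1 p) //= eqxx mul1r mulr0.
rewrite ksgn0 add0r big1 ?addr0 // => p' pp'.
have -> : (inl (inr p) == inl (inr p') :> J) = false by rewrite eq_sym in pp';
  apply/negbTE.
by rewrite mulr0 mul0r !ksgn0 addr0 scaler0.
Qed.

Lemma pairing_coord_z k X : mgr k X -> pairing n om k (- n) X (D (inr tt)) = 0.
Proof.
move=> hX; rewrite (pairing_D (inr tt) hX) big1 // => p _.
by rewrite /= mulr0 mul0r !ksgn0 addr0 scaler0.
Qed.

(** Pairing with the fields of [v] and [u] recovers [X] on [dR u] and [dR v], but nothing recovers
    it on [dR z]. There the equation alpha(X) = 0 takes over: once the values on [dR u] vanish it
    reads [kz] X(dR z) = 0. *)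
Lemma pairing_nondegenerate k X : mgr k X -> X (n + 1) darboux_form = 0 ->
  (forall j, pairing n om k (- deg j) X (D j) = 0) -> X = 0.
Proof.
move=> hX aX pX; apply: (tangent_eq F hX (mgr0 _ k)).
have kill c i (a : C) : c != 0 -> c *: ksgn i a = 0 -> a = 0.
  move=> c0 /eqP; rewrite scaler_eq0 (negbTE c0) => /eqP e0.
  by rewrite -[a](ksgnK i) e0 ksgn0.
have eu p : X (du p + 1) (dR O (u p)) = 0.
  apply: (kill (kap p) ((k - 1) * (n - du p + 1))) => //.
  by rewrite -pairing_coord_v //; apply: (pX (inl (inr p))).
case=> [[p|p]|[]]; first exact: eu.
  apply: (kill (kap p) ((- du p - 1) * (n - du p + 1 + (k - 1)))) => //.
  by rewrite -pairing_coord_u //; apply: (pX (inl (inl p))).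
apply: (kill kz 0) => //; rewrite ksgn_even // -[RHS]aX (tangent_darboux_form hX).
by rewrite big1 ?add0r // => p _; rewrite eu mulr0 ksgn0 scaler0.
Qed.

Lemma pairing_represents k (phi : int -> T -> C) :
  is_ghom (galg_id C) (M := T) (N := reg C) (k + n) phi ->
  phi (- n) (D (inr tt)) = 0 ->
  exists X : T, [/\ mgr k X, X (n + 1) darboux_form = 0 &
    forall l Y, mgr l Y ->
      ksgn (k + (n + k) * l) (pairing n om k l X Y) = phi l Y].
Proof.
move=> hphi phiz.
have hD j : gdeg (- deg j + (k + n)) (phi (- deg j) (D j)).
  exact: (ghom_deg hphi (coord_vector_deg j) erefl).
(* The values on [dR u] and [dR v] invert [pairing_coord_v] and [pairing_coord_u]; each exponent
   adds the sign of [pairing_ghom] to the one found there. *)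
pose xu p : C := ksgn (k + (n + k) * (- (n - du p)) + (k - 1) * (n - du p + 1))
  ((kap p)^-1 *: phi (- (n - du p)) (D (inl (inr p)))).
pose xv p : C := ksgn (k + (n + k) * (- du p) +
    (- du p - 1) * (n - du p + 1 + (k - 1)))
  ((kap p)^-1 *: phi (- du p) (D (inl (inl p)))).
(* The value on [dR z] is free for the pairing and is chosen to solve alpha(X) = 0. *)
pose xz : C := - (kz^-1 *:
  \sum_p kap p *: ksgn ((k - 1) * (n - du p)) (f (v p) * xu p)).
have hxu p : gdeg (du p + k) (xu p).
  apply: (@gmod_ksgn _ _ (reg C)); apply: gdegZ.
  by have := hD (inl (inr p)); congr gdeg => /=; ring.
have hxv p : gdeg (n - du p + k) (xv p).
  apply: (@gmod_ksgn _ _ (reg C)); apply: gdegZ.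
  by have := hD (inl (inl p)); congr gdeg => /=; ring.
have hxz : gdeg (n + k) xz.
  apply: (@gmodN _ _ (reg C)); apply: gdegZ; apply: (@gmod_sum _ _ (reg C)) => p _.
  apply: gdegZ; apply: (@gmod_ksgn _ _ (reg C)).
  by apply: gdegM_eq (gmor_deg f (hv p)) (hxu p) _; ring.
pose x (j : J) : C := match j with inl (inl p) => xu p | inl (inr p) => xv p | inr _ =>
  xz end.
have [j|X hX eX] := tangent_ext F f (k := k) (x := x).
  case: j => [[p|p]|[]] /=; [exact: hxu|exact: hxv|exact: hxz].
exists X; split=> //.
  rewrite (tangent_darboux_form hX) (eX (inr tt)) /= /xz scalerN scalerA mulfV //.
  rewrite scale1r; apply/eqP; rewrite subr_eq0; apply/eqP; apply: eq_bigr => p _.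
  by rewrite (eX (inl (inl p))).
apply: (tangent_ghom_eq (pairing_ghom hX) hphi) => -[[p|p]|[]] /=.
- rewrite pairing_coord_u // (eX (inl (inr p))) /= /xv !ksgnZ !ksgn_ksgn scalerA mulfV
  //.
  by rewrite scale1r ksgn_even //; parity.
- rewrite pairing_coord_v // (eX (inl (inl p))) /= /xu !ksgnZ !ksgn_ksgn scalerA mulfV
  //.
  by rewrite scale1r ksgn_even //; parity.
- by rewrite pairing_coord_z // ksgn0 phiz.
Qed.

(** * The Reeb splitting and the fibre of alpha *)

Hypothesis md_om : md (n + 2) om = 0.
Variables (hal : mgr (n + 1) darboux_form) (hcl : closed_on f n darboux_form).
Local Notation KK := (contact_fib hal hcl).
Local Notation sgnp k l := (k + (n + k) * l).

Let ev (X : T) : C := X (n + 1) darboux_form.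

Let ev_deg k X : mgr k X -> gdeg (k + n) (ev X).
Proof. by move=> hX; apply: tangent_deg hX hal _; ring. Qed.

Let ev_md k X : mgr k X -> ev (md k X) = cd (ev X).
Proof. exact: (form_dual_dgmor hal hcl).2. Qed.

(* R is the Reeb field. *)
Let R : T := (kz^-1)%:A *: D (inr tt).

Let hR : mgr (- n) R.
Proof. exact/gmodK/(coord_vector_deg (inr tt)). Qed.

Let Rw j : R (deg j + 1) (dR O (w j)) = kz^-1 *: ((inr tt == j)%:R : C).
Proof. by rewrite -coord_vectorE -[RHS]mulr_algl. Qed.

Let ev_R : ev R = 1.
Proof.
rewrite /ev (tangent_darboux_form hR) (Rw (inr tt)) eqxx scalerA mulfV // scale1r.
rewrite big1 ?add0r // => p _.
by rewrite (Rw (inl (inl p))) scaler0 mulr0 ksgn0 scaler0.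
Qed.

(** On [dR (w j)] the differential of R takes a value of degree [deg j - n + 1], which is positive
    because no coordinate has degree below [n]. *)
Let md_R : md (- n) R = 0.
Proof.
have hdR := md_deg hR; apply: (tangent_eq F hdR (mgr0 T (- n + 1))) => j.
apply: (gdeg_npos _ (tangent_deg hdR (frame_dR_deg F j) erefl)).
rewrite (_ : _ - 1 = deg j - n + 1); last by ring.
rewrite ltr_wpDl // subr_ge0; case: j => [[p|p]|[]] //=.
by rewrite lerBrDl gerDr.
Qed.

Let pairing_R k X : mgr k X -> pairing n om k (- n) X R = 0.
Proof.
move=> hX; rewrite /R -[- n]add0r.
rewrite (pairingZr kap hu hv (gdeg_scalar C _) hX (coord_vector_deg (inr tt))).
by rewrite pairing_coord_z // mulr0.
Qed.

Let R_pairing l Y : mgr l Y -> pairing n om (- n) l R Y = 0.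
Proof.
move=> hY; rewrite (pairingE kap hu hv hR hY) big1 // => p _.
rewrite /pairing_form (Rw (inl (inl p))) (Rw (inl (inr p))) /=.
by rewrite !scaler0 mul0r mulr0 !ksgn0 addr0 scaler0.
Qed.

Let proj (X : T) : T := X - ev X *: R.

Let evR_deg k X : mgr k X -> mgr k (ev X *: R).
Proof. by move=> hX; apply: gmodZ (ev_deg hX) hR _; ring. Qed.

Let proj_deg k X : mgr k X -> mgr k (proj X).
Proof. by move=> hX; apply: mgrB => //; apply: evR_deg. Qed.

Let ev_proj k X : mgr k X -> ev (proj X) = 0.
Proof.
move=> hX; have -> : ev (proj X) = ev X - ev X * ev R by [].
by rewrite ev_R mulr1 subrr.
Qed.

Let md_cR i c : gdeg i c -> md (i - n) (c *: R) = cd c *: R.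
Proof. by move=> hc; rewrite md_leibniz // md_R scaler0 ksgn0 addr0. Qed.

(** Since alpha^vee commutes with the differentials and R is a cycle, the splitting of T along R is
    one of complexes. *)
Let md_proj k X : mgr k X -> md k (proj X) = proj (md k X).
Proof.
move=> hX; rewrite /proj md_add //; last exact/gmodN/evR_deg.
rewrite mdN; last exact: evR_deg.
by rewrite ev_md // -(md_cR (ev_deg hX)) addrK.
Qed.

Let pairing_proj k l X Y : mgr k X -> mgr l Y ->
  pairing n om k l X (proj Y) = pairing n om k l X Y.
Proof.
move=> hX hY; have hcR := evR_deg hY.
rewrite /proj (pairingDr kap hu hv hX hY (gmodN hcR)) -scaleNr.
have hc : gdeg (l + n) (- ev Y) by apply: (@gmodN _ _ (reg C)); apply: ev_deg.
have el : l = l + n + - n by ring.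
by rewrite [in X in _ + X]el (pairingZr kap hu hv hc hX hR) pairing_R // mulr0 addr0.
Qed.

Let proj_pairing k l X Y : mgr k X -> mgr l Y ->
  pairing n om k l (proj X) Y = pairing n om k l X Y.
Proof.
move=> hX hY; have hcR := evR_deg hX.
rewrite /proj (pairingDl kap hu hv hX (gmodN hcR) hY) -scaleNr.
have hc : gdeg (k + n) (- ev X) by apply: (@gmodN _ _ (reg C)); apply: ev_deg.
have el : k = k + n + - n by ring.
by rewrite [in X in _ + X]el (pairingZl kap hu hv hc hR hY) R_pairing // mulr0 ksgn0
  addr0.
Qed.

(* The fibre is T + C[n-1]; contract is a homotopy from the identity to the
   projection (Y, y) |-> (Y - alpha(Y) R, 0). *)
Let contract (l : int) (Yy : KK) : KK := (ksgn (l - 1) ((Yy.2 : C) *: R), 0).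

Let contract_deg l (Yy : KK) : mgr l Yy -> mgr (l - 1) (contract l Yy).
Proof.
case: Yy => Y y [/= hY hy]; split=> /=; last exact: gdeg0.
by apply: (@gmod_ksgn _ _ T); apply: gmodZ hy hR _; rewrite addrK.
Qed.

Let fib_eq (a b : KK) : a.1 = b.1 -> a.2 = b.2 -> a = b.
Proof. by case: a b => [a1 a2] [b1 b2] /= -> ->. Qed.

(** In the first component the two terms containing dy have opposite signs and alpha(Y) R remains;
    in the second, alpha(R) = 1 returns y. *)
Let contract_homotopy l (Yy : KK) : mgr l Yy ->
  Yy = ((proj Yy.1, 0) : KK) + md (l - 1) (contract l Yy) + contract (l + 1) (md l Yy).
Proof.
case: Yy => Y y [/= hY hy].
have hyR : mgr (l - 1) ((y : C) *: R) by apply: gmodZ hy hR _; rewrite addrK.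
apply: fib_eq.
  change (Y = proj Y + md (l - 1) (ksgn (l - 1) ((y : C) *: R)) +
    ksgn (l + 1 - 1) ((ksgn l (ev Y) + cd (y : C)) *: R)).
  rewrite addrK md_ksgn //.
  have -> : md (l - 1) ((y : C) *: R) = cd (y : C) *: R.
    by rewrite -{1}(addrK n (l - 1)) md_cR.
  rewrite scalerDl ksgn_scale ksgnD ksgnK addrACA subrK -[LHS]addr0; congr (_ + _).
  by rewrite /ksgn odd_absD /=; case: odd; rewrite /= ?subrr ?addNr.
have ksE t (X : T) : ev (ksgn t X) = ksgn t (ev X) by rewrite /ksgn; case: ifP.
change ((y : C) = 0 + (ksgn (l - 1) (ev (ksgn (l - 1) ((y : C) *: R))) + cd (0 : C)) +
  0).
rewrite ksE ksgnK (gder0 (cd_der C)) add0r !addr0.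
by rewrite -[LHS]mulr1 -ev_R.
Qed.

Let Phi : int -> KK -> shift n (dual KK) :=
  fib_pairing (n := n) (hal := hal) (hcl := hcl) om.

Let PhiE k l (Xx Yy : KK) : mgr l Yy ->
  Phi k Xx l Yy = ksgn (sgnp k l) (pairing n om k l Xx.1 Yy.1).
Proof. by move=> hYy; rewrite /Phi /fib_pairing asboolT. Qed.

Let Phi0 k l (Xx Yy : KK) : ~ mgr l Yy -> Phi k Xx l Yy = 0.
Proof. by move=> hYy; rewrite /Phi /fib_pairing asboolF. Qed.

Let dual_mdE r (G : dual KK) l (Yy : KK) : mgr l Yy ->
  md r G l Yy = cd (G l Yy) - ksgn r (G (l + 1) (md l Yy)).
Proof. by move=> hYy; rewrite /= /hom_d asboolT. Qed.

Let dual_md0 r (G : dual KK) l (Yy : KK) : ~ mgr l Yy -> md r G l Yy = 0.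
Proof. by move=> hYy; rewrite /= /hom_d asboolF. Qed.

(** In the differential of the functional attached to X, the terms pairing X with dY cancel by
    [pairing_md], and the term pairing dX with Y is left with the sign prescribed in degree
    [k + 1]. *)
Lemma fib_pairing_dgmor :
  is_dgmor (M := KK) (N := shift n (dual KK)) (fib_pairing (n := n) (hal := hal) (hcl
    := hcl) om).
Proof.
split; first split.
- move=> k [X x] [/= hX hx]; have [p1 p2 p3] := pairing_ghom hX.
  rewrite addr0; split; last by move=> l Yy hYy; rewrite /fib_pairing; case: asboolP.
  split=> [l [Y y] hY|l [Y y] [Y' y'] hY hY'|i l a [Y y] ha hY]; rewrite /fib_pairing
    !asboolT //.
  + exact: (p1 l Y hY.1).
  + exact: (p2 l Y Y' hY.1 hY'.1).
  + exact: mgrD.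
  + exact: (p3 i l a Y ha hY.1).
  + exact: mgrZ.
- move=> k [X x] [X' x'] [/= hX hx] [/= hX' hx']; apply/funext => l; apply/funext =>
  -[Y y].
  rewrite /fib_pairing !fctE; case: asboolP => [[/= hY _]|_]; last by rewrite addr0.
  by rewrite (pairingDl kap hu hv hX hX' hY) ksgnD.
- move=> i k a [X x] ha [/= hX hx]; apply/funext => l; apply/funext => -[Y y].
  rewrite mul0r ksgn_even // /fib_pairing.
  have -> : forall G : shift n (dual KK), (a *: G) l (Y, y) = a * (G l (Y, y) : C) by
    [].
  case: asboolP => [[/= hY _]|_]; last by rewrite mulr0.
  rewrite (pairingZl kap hu hv ha hX hY) ksgn_ksgn [RHS]ksgn_mulr.
  by apply: eq_ksgn; parity.
move=> k Xx [hX hx]; apply/funext => l; apply/funext => Yy.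
change (Phi (k + 1) (md k Xx) l Yy = (md (k + n) (Phi k Xx : dual KK) : dual KK) l Yy).
have [hYy|nYy] := pselect (mgr l Yy); last by rewrite Phi0 // dual_md0.
have hdYy := md_deg hYy; have [hY hy] := hYy.
rewrite dual_mdE // !PhiE // cd_ksgn (pairing_md hu hv md_om hX hY).
rewrite ksgnD !ksgn_ksgn [RHS]addrAC.
have -> : ksgn (sgnp k l) (pairing n om k (l + 1) Xx.1 (md l Yy.1)) =
    ksgn (k + n + sgnp k (l + 1)) (pairing n om k (l + 1) Xx.1 (md l Yy).1).
  by apply: eq_ksgn; parity.
by rewrite subrr add0r; apply: eq_ksgn; parity.
Qed.

(** Precomposed with the projection to ker(alpha), a functional on the fibre kills the Reeb
    direction and is therefore represented by a field X in ker(alpha). The last clause says that dX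
    represents dG; it uses that the projection commutes with the differentials. *)
Let dual_represents k (G : dual KK) : mgr (k + n) G ->
  exists X : T, [/\ mgr k X, ev X = 0,
    forall l Yy, mgr l Yy -> Phi k (X, 0) l Yy = G l (proj Yy.1, 0) &
    forall l (Y : T), mgr l Y ->
      ksgn (sgnp (k + 1) l) (pairing n om (k + 1) l (md k X) Y) =
      md (k + n) G l (proj Y, 0)].
Proof.
move=> hG; have [[G1 G2 G3] _] := hG.
have hproj0 l (Y : T) : mgr l Y -> mgr l ((proj Y, 0) : KK).
  by move=> hY; split=> /=; [apply: proj_deg|apply: gdeg0].
pose phi l (Y : T) : C := G l (proj Y, 0).
have hphi : is_ghom (galg_id C) (M := T) (N := reg C) (k + n) phi.
  split=> [l Y hY|l Y Y' hY hY'|i l a Y ha hY].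
  - by apply: G1; apply: hproj0.
  - have e2 := G2 l _ _ (hproj0 l Y hY) (hproj0 l Y' hY'); rewrite /phi -e2.
    congr (G l _); apply: fib_eq; last by rewrite [RHS]addr0.
    change (Y + Y' - (ev Y + ev Y') *: R = Y - ev Y *: R + (Y' - ev Y' *: R)).
    by rewrite scalerDl opprD addrACA.
  - have e3 := G3 i l a _ ha (hproj0 l Y hY); rewrite /phi -[RHS]e3.
    congr (G (i + l) _); apply: fib_eq; last by rewrite [RHS]scaler0.
    change (a *: Y - (a * ev Y) *: R = a *: (Y - ev Y *: R)).
    by rewrite scalerBr -(scalerA a (ev Y) R).
(* The coordinate field of [z] is [kz] R, which the projection kills. *)
have phiz : phi (- n) (D (inr tt)) = 0.
  have ez : ev (D (inr tt)) = kz%:A.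
    have -> : D (inr tt) = kz%:A *: R.
      by rewrite /R scalerA mulr_algl scalerA mulfV // scale1r scale1r.
    have -> : ev (kz%:A *: R) = kz%:A * ev R by [].
    by rewrite ev_R mulr1.
  rewrite /phi (_ : proj (D (inr tt)) = 0); last first.
    by rewrite /proj ez /R scalerA mulr_algl scalerA mulfV // scale1r scale1r subrr.
  exact: (ghom0 (And3 G1 G2 G3) (- n)).
have [X [hX aX eX]] := pairing_represents hphi phiz.
exists X; split=> // [l Yy hYy|l Y hY].
  by rewrite PhiE // eX //; case: hYy.
have hdX := md_deg hX; have hdY := md_deg hY.
have hpY := hproj0 l Y hY.
have -> : md (k + n) G l (proj Y, 0) = cd (phi l Y) - ksgn (k + n) (phi (l + 1) (md l
  Y)).
  rewrite dual_mdE //; congr (_ - ksgn _ (G _ _)); apply: fib_eq => /=.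
    exact: md_proj.
  have -> : form_dual n darboux_form l (proj Y) = 0 by apply: (ev_proj hY).
  by rewrite ksgn0 add0r (gder0 (cd_der C)).
rewrite -!eX // cd_ksgn (pairing_md hu hv md_om hX hY) ksgnD !ksgn_ksgn [RHS]addrAC.
have -> : ksgn (sgnp k l) (pairing n om k (l + 1) X (md l Y)) =
    ksgn (k + n + sgnp k (l + 1)) (pairing n om k (l + 1) X (md l Y)).
  by apply: eq_ksgn; parity.
by rewrite subrr add0r; apply: eq_ksgn; parity.
Qed.

Let contractD l (Yy Yy' : KK) : contract l (Yy + Yy') = contract l Yy + contract l Yy'.
Proof.
apply: fib_eq; last by rewrite [RHS]addr0.
change (ksgn (l - 1) (((Yy.2 : C) + Yy'.2) *: R) =
  ksgn (l - 1) ((Yy.2 : C) *: R) + ksgn (l - 1) ((Yy'.2 : C) *: R)).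
by rewrite scalerDl ksgnD.
Qed.

Let ksgn_pair t (Yy : KK) : ksgn t Yy = (ksgn t Yy.1, ksgn t Yy.2).
Proof. by case: Yy => Y y; rewrite /ksgn; case: ifP. Qed.

Let contractZ i l a (Yy : KK) : contract (i + l) (a *: Yy) = ksgn i (a *: contract l
  Yy).
Proof.
rewrite ksgn_pair; apply: fib_eq; last by rewrite /= scaler0 ksgn0.
change (ksgn (i + l - 1) ((a * (Yy.2 : C)) *: R) =
  ksgn i (a *: ksgn (l - 1) ((Yy.2 : C) *: R))).
by rewrite ksgnZ ksgn_ksgn -(scalerA a (Yy.2 : C) R) addrA.
Qed.

Let contract0 l : contract l 0 = 0.
Proof. by apply: fib_eq => //=; rewrite scale0r ksgn0. Qed.

(** On ker(alpha) the pairing is perfect, and the homotopy absorbs the rest of the fibre. It is used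
    twice: on a cycle, to move it into ker(alpha) up to a boundary, and transposed, on a closed
    functional. *)
Lemma fib_pairing_equivalence :
  is_equivalence (M := KK) (N := shift n (dual KK)) Phi.
Proof.
have hPhi := fib_pairing_dgmor; split=> //.
apply: quasi_isoS => [k Xx G hXx dXx hG eG | k G hG dG].
  have [X' [hX' aX' _ eX']] := dual_represents (hG : mgr (k + n) (G : dual KK)).
  have [hX hx] := hXx; have hpX := proj_deg hX; have hdX' := md_deg hX'.
  have hX'0 : mgr k ((X', 0) : KK) by split=> //=; apply: gdeg0.
  (* Both fields lie in ker(alpha) and have the same pairings with all coordinate fields. *)
  have pX : proj Xx.1 = md k X'.
    apply: subr0_eq; apply: (pairing_nondegenerate (k := k + 1)).
    - exact: mgrB.
    - change (ev (proj Xx.1) - ev (md k X') = 0).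
      by rewrite (ev_proj hX) ev_md // aX' (gder0 (cd_der C)) subrr.
    have e1 l (Y : T) : mgr l Y ->
        pairing n om (k + 1) l (md k X') Y = pairing n om (k + 1) l Xx.1 Y.
      move=> hY; apply: (can_inj (ksgnK (sgnp (k + 1) l))); rewrite eX' //.
      transitivity (Phi (k + 1) Xx l (proj Y, 0)); first by rewrite eG.
      rewrite PhiE ?pairing_proj //.
      by split=> /=; [apply: proj_deg|apply: gdeg0].
    move=> j; have hD := coord_vector_deg j.
    have := pairingDl kap hu hv (mgrB hpX hdX') hdX' hD.
    rewrite subrK (proj_pairing hX hD) (e1 _ _ hD) => e.
    by apply: (@addIr _ (pairing n om (k + 1) (- deg j) Xx.1 (D j))); rewrite add0r -e.
  have hc := contract_deg hXx; rewrite addrK in hc.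
  (* [Xx] is a cycle, so it differs from its projection by the boundary of [contract (k + 1) Xx];
     the projection is the boundary of [(X', 0)]. *)
  exists (((X', 0) : KK) + contract (k + 1) Xx); first exact: mgrD.
  rewrite md_add // [LHS](contract_homotopy hXx) dXx contract0 addr0 addrK.
  congr (_ + _); apply: fib_eq => //=.
  by rewrite -/(ev X') /form_dual -/(ev X') aX' ksgn0 (gder0 (cd_der C)) addr0.
have hGd : mgr (k + 1 + n) (G : dual KK) := hG.
have dGd : md (k + 1 + n) (G : dual KK) = 0 := dG.
have [[hGg _] hG0] : hom_gr (cdga_id C) (k + 1 + n) G /\
    (forall l Yy, ~ mgr l Yy -> G l Yy = 0) by case: (hGd).
have [X [hX aX eX eX']] := dual_represents hGd; have hdX := md_deg hX.
have hX0 : mgr (k + 1) ((X, 0) : KK) by split=> //=; apply: gdeg0.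
have dX : md (k + 1) X = 0.
  apply: (pairing_nondegenerate hdX).
    by change (ev (md (k + 1) X) = 0); rewrite ev_md // aX (gder0 (cd_der C)).
  move=> j; apply: (can_inj (ksgnK (sgnp (k + 1 + 1) (- deg j)))).
  by rewrite eX' ?dGd ?ksgn0 //; apply: coord_vector_deg.
(* As G is closed, the differential of G composed with the homotopy is, with this sign, the
   difference between G and its restriction to ker(alpha). *)
pose H : dual KK := fun l Yy =>
  if `[< mgr l Yy >] then ksgn (k + 1 + n) (G (l - 1) (contract l Yy)) else 0.
have HE l Yy : mgr l Yy -> H l Yy = ksgn (k + 1 + n) (G (l - 1) (contract l Yy)).
  by move=> h; rewrite /H asboolT.
have H0 l Yy : ~ mgr l Yy -> H l Yy = 0 by move=> h; rewrite /H asboolF.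
have hH : mgr (k + n) H.
  split=> //; split=> [l Yy hY|l Yy Yy' hY hY'|i l a Yy ha hY].
  - rewrite HE //; apply: gmod_ksgn.
    by apply: (ghom_deg hGg (contract_deg hY)); ring.
  - rewrite !HE //; last exact: mgrD.
    by rewrite contractD (ghomD hGg) ?ksgnD //; apply: contract_deg.
  - rewrite !HE //; last exact: mgrZ.
    have hc := contract_deg hY.
    have hac : mgr (i + l - 1) (a *: contract l Yy) by apply: gmodZ ha hc _; ring.
    rewrite contractZ (ghom_ksgn hGg) // (ghomZ hGg ha hc); last by ring.
    rewrite ksgnZ !ksgn_ksgn; apply: eq_ksgn; parity.
exists (X, 0), H; split=> //.
  by apply: fib_eq => //=; rewrite /form_dual -/(ev X) aX ksgn0 (gder0 (cd_der C))
    addr0.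
apply/funext => l; apply/funext => Yy.
change (G l Yy = Phi (k + 1) (X, 0) l Yy + (md (k + n) H : dual KK) l Yy).
have [hYy|nYy] := pselect (mgr l Yy); last by rewrite hG0 // Phi0 // dual_md0 // addr0.
have hdYy := md_deg hYy; have hc := contract_deg hYy; have hdc := md_deg hc.
have hcd := contract_deg hdYy; rewrite addrK in hcd; rewrite subrK in hdc.
have hp : mgr l ((proj Yy.1, 0) : KK).
  by split=> /=; [apply: proj_deg; case: hYy|apply: gdeg0].
have dGE t Xx : mgr t Xx -> cd (G t Xx) = ksgn (k + 1 + n) (G (t + 1) (md t Xx)).
  move=> hXx; apply: subr0_eq; have := dual_mdE (k + 1 + n) G hXx.
  by rewrite dGd => <-.
rewrite eX // dual_mdE // !HE // cd_ksgn dGE // ksgnK subrK addrK.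
rewrite ksgn_ksgn ksgn_odd ?opprK; last by parity.
by rewrite {1}(contract_homotopy hYy) !(ghomD hGg) ?addrA //; apply: mgrD.
Qed.

End Coefficients.

End Contact.
(** * Restriction to the truncation *)

Section Truncation.
Variables (K : fieldType) (A C : cdga K) (pi : cdgamor A C).
Hypothesis hpi : is_H0 pi.

Lemma H0_neg k a : gdeg k a -> k < 0 -> pi a = 0.
Proof.
case: hpi => conc _ _ ha k0; apply: gdeg_inj (gmor_deg pi ha) (conc _) _.
by rewrite lt_eqF.
Qed.

Lemma H0_cd a : pi (cd a) = 0.
Proof.
case: hpi => conc _ _; rewrite cmor_d; apply: (@gdeg_npos _ _ 1) => //.
by rewrite -[1]add0r; apply: gdeg_cd.
Qed.

Variables (S : A -> Prop) (O : deRham S).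

(** Each term of the Leibniz rule keeps one of the two factors as a coefficient, and both factors
    die in the truncation. *)
Lemma H0_tangent_dRM k (X : tangent O pi) i j t a b : mgr k X ->
  gdeg i a -> gdeg j b -> pi a = 0 -> pi b = 0 -> t = i + j + 1 ->
  X t (dR O (a * b)) = 0.
Proof.
move=> hX ha hb pa pb ->; have hF := tangent_ghom hX.
have hda := dR_deg O ha erefl; have hdb := dR_deg O hb erefl.
rewrite (dR_M O ha hb) (ghomD hF) ?(ghom_ksgn hF).
- rewrite (ghomZ hF ha hdb) ?(ghomZ hF hb hda); [|ring|ring].
  by rewrite pa pb !scale0r !ksgn0 addr0.
- by apply: gmodZ hb hda _; ring.
- by apply: gmodZ ha hdb _; ring.
- by apply/gmod_ksgn/(gmodZ ha hdb); ring.
- by apply/gmod_ksgn/(gmodZ hb hda); ring.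
Qed.

End Truncation.

Section ClosedOnTruncation.
Variable K : fieldType.
Variables (A : cdga K) (S : A -> Prop) (O : deRham S).
Variables (P : finType) (n : int) (u v : P -> A) (z : A) (du : P -> int).
Variables (kap : P -> K) (kz : K).
Hypothesis n_lt_du : forall p, n < du p.
Hypothesis hu : forall p, gdeg (du p) (u p).
Hypothesis hv : forall p, gdeg (n - du p) (v p).
Hypothesis hz : gdeg n z.
Variables (C : cdga K) (pi : cdgamor A C).
Hypothesis hpi : is_H0 pi.
Hypothesis hXz : forall k (X : tangent O pi), mgr k X ->
  X (n + 1 + 1) (dR O (cd z)) = 0.

(** The differential of v dR u has coefficients dv and v. The first is a boundary, and the second
    has negative degree because of the strict bound [n < du p]; both die in the truncation. The term
    in dz is the hypothesis [hXz]. *)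
Lemma darboux_form_closed_on : closed_on pi n (darboux_form O u v z kap kz).
Proof.
move=> k X hX; have hF := tangent_ghom hX.
have hdu p := dR_deg O (hu p) erefl.
have hvdu p : mgr (n + 1) (v p *: dR O (u p)) by apply: gmodZ (hv p) (hdu p) _; ring.
have hkvdu p : mgr (n + 1) ((kap p)%:A *: (v p *: dR O (u p))).
  exact: gmodK.
have hdz := dR_deg O hz erefl.
have hkdz : mgr (n + 1) (kz%:A *: dR O z).
  exact: gmodK.
rewrite /darboux_form md_add //; last exact: gmod_sum.
rewrite md_sum // md_K // (dR_d O hz) (ghomD hF); last 2 first.
- by apply: gmod_sum => p _; apply: md_deg.
- rewrite -(dR_d O hz); apply: gmodZ (gdeg_scalar _ _) (md_deg hdz) _.
  by rewrite add0r.
rewrite (ghom_sum hF) => [|p _]; last exact: md_deg.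
have hdcz : mgr (n + 1 + 1) (dR O (cd z)) by apply: dR_deg (gdeg_cd hz) erefl.
rewrite (ghomK hF); last exact: gmodN.
rewrite (ghomN hF) // (hXz hX) oppr0 scaler0 addr0 big1 // => p _.
rewrite md_K // (ghomK hF); last exact: md_deg.
have en : n + 1 = n - du p + (du p + 1) by ring.
have h1 : mgr (n + 1 + 1) (cd (v p) *: dR O (u p)).
  by apply: gmodZ (gdeg_cd (hv p)) (hdu p) _; ring.
have h2 : mgr (n + 1 + 1) (v p *: md (du p + 1) (dR O (u p))).
  by apply: gmodZ (hv p) (md_deg (hdu p)) _; ring.
rewrite {2}en (md_leibniz (hv p) (hdu p)) (ghomD hF) //; last exact: gmod_ksgn.
rewrite (ghom_ksgn hF) // (ghomZ hF (gdeg_cd (hv p)) (hdu p)); last by ring.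
rewrite (ghomZ hF (hv p) (md_deg (hdu p))); last by ring.
by rewrite (H0_cd hpi) (H0_neg hpi (hv p)) ?subr_lt0 // !scale0r !ksgn0 addr0 scaler0.
Qed.

End ClosedOnTruncation.

(** * Derivations applied to a Hamiltonian *)

Section Hamiltonian.
Variables (K : fieldType) (A : cdga K) (I : finType) (deg : I -> int).
Variables (X : std_coords A deg) (C : galg K) (f : galgmor A C) (M : gmod C).
Variable D : A -> M.
Hypothesis hD : is_gder f (@scalars K A) 1 D.

Lemma der_hamiltonian n h : odd `|n|%N -> gdeg (n + 1) h ->
  D h = \sum_c f (sc_D X c h) *: D (sc_w X c).
Proof.
move=> nodd hh; rewrite (der_expansion X hD hh); apply: eq_bigr => c _.
by rewrite ksgn_even //; move: nodd; parity.
Qed.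

Lemma sc_D_pos c h k : gdeg k h -> 0 < k - deg c -> sc_D X c h = 0.
Proof.
by move=> hh; move/gdeg_npos; apply; apply: (gder_deg (sc_D_der X c) hh).
Qed.

End Hamiltonian.

Lemma frame_eq (K : fieldType) (A : cdga K) (S : A -> Prop) (O : deRham S)
    (J : finType) (deg deg' : J -> int) (w w' : J -> A) :
  deg =1 deg' -> w =1 w' -> frame O deg w -> frame O deg' w'.
Proof. by move=> /funext -> /funext ->. Qed.

(** * Darboux submersions *)

Section Submersion.
Variables (K : fieldType) (l : nat) (m q : 'I_l.+1 -> nat).
Variables (B : cdga K) (DB : contact_darboux m B).
Variables (A : cdga K) (DA : darboux_submersion q DB A).
Local Notation n := (nshift l).
Local Notation beta := (ds_beta DA).

Lemma nshift_odd : odd `|n|%N.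
Proof. by rewrite /nshift abszN absz_nat /= odd_double. Qed.

Lemma deg_pos_le0 (d : 'I_l.+1 -> nat) (p : dindex d) : deg_pos p <= 0.
Proof. by rewrite /deg_pos oppr_le0. Qed.

Lemma nshift_lt (d : 'I_l.+1 -> nat) (p : dindex d) : n < deg_pos p.
Proof.
rewrite /deg_pos /nshift ltrN2 ltz_nat; apply: leq_trans (ltn_ord (tag p)) _.
by rewrite ltnS -addnn leq_addr.
Qed.

Lemma deg_momE (d : 'I_l.+1 -> nat) (p : dindex d) : deg_mom p = n - deg_pos p.
Proof. by rewrite /deg_mom /deg_pos opprK. Qed.

Lemma base_x_deg p : gdeg (deg_pos p) (base_x DB p).
Proof. exact: (sc_w_deg DB (cx p)). Qed.

Lemma base_y_deg p : gdeg (n - deg_pos p) (base_y DB p).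
Proof. by rewrite -deg_momE; apply: (sc_w_deg DB (cy p)). Qed.

Lemma base_z_deg : gdeg n (base_z DB).
Proof. exact: (sc_w_deg DB (cz m)). Qed.

Lemma src_u_deg p : gdeg (deg_pos p) (src_u DA p).
Proof. exact: (sc_w_deg DA (cu m p)). Qed.

Lemma src_v_deg p : gdeg (n - deg_pos p) (src_v DA p).
Proof. by rewrite -deg_momE; apply: (sc_w_deg DA (cv m p)). Qed.

Lemma src_xE p : src_x DA p = beta (base_x DB p).
Proof. exact: (ds_base DA (cx p)). Qed.

Lemma src_yE p : src_y DA p = beta (base_y DB p).
Proof. exact: (ds_base DA (cy p)). Qed.

Lemma src_zE : src_z DA = beta (base_z DB).
Proof. exact: (ds_base DA (cz m)). Qed.

Lemma tag0_deg (d : 'I_l.+1 -> nat) (p : dindex d) : (0 < tag p)%N = false ->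
  deg_pos p = 0.
Proof. by rewrite /deg_pos lt0n => /negbFE/eqP ->. Qed.

(** The Hamilton equation extends to i = 0, where the data do not state it: d vanishes on A^0-type
    coordinates, and the derivative of H along y^n has degree 1. The sums over all pairs can then be
    treated uniformly. *)
Lemma base_dx p : cd (base_x DB p) = sc_D DB (cy p) (cd_H DB).
Proof.
case: (boolP (0 < tag p)%N) => [/(cd_dx DB) //|/negbTE/tag0_deg p0].
rewrite cd_deg0; last by rewrite -p0; apply: base_x_deg.
rewrite (sc_D_pos DB (cd_H_deg DB)) //= deg_momE p0 subr0.
by rewrite addrAC subrr.
Qed.

Lemma src_du p : cd (src_u DA p) = sc_D DA (cv m p) (ds_G DA).
Proof.
case: (boolP (0 < tag p)%N) => [/(ds_du DA) //|/negbTE/tag0_deg p0].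
rewrite cd_deg0; last by rewrite -p0; apply: src_u_deg.
rewrite (sc_D_pos DA (ds_G_deg DA)) //= deg_momE p0 subr0.
by rewrite addrAC subrr.
Qed.

Lemma base_Hz : sc_D DB (cz m) (cd_H DB) = 0.
Proof. by rewrite (sc_D_pos DB (cd_H_deg DB)) //= addrAC subrr. Qed.

Section Forms.
Variables (S : A -> Prop) (O : deRham S).
Hypothesis scS : forall s : A, scalars s -> S s.

Lemma dR_G : dR O (ds_G DA) = \sum_p
  (cd (src_v DA p) *: dR O (src_u DA p) + cd (src_u DA p) *: dR O (src_v DA p)).
Proof.
rewrite (der_hamiltonian DA (gderS (dR_der O) scS) nshift_odd (ds_G_deg DA)).
rewrite big_sumType /= big1 ?add0r; last first.
  by move=> c _; rewrite (ds_G_uv DA) scale0r.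
rewrite big_sumType big_split /=; congr (_ + _); apply: eq_bigr => p _.
  by rewrite (ds_dv DA).
by rewrite src_du.
Qed.

Lemma scalar_gmor (B' A' : galg K) (g : galgmor B' A') b : scalars b -> scalars (g b).
Proof. by case=> k ->; exists k; rewrite linearZ rmorph1. Qed.

(** As a derivation on B along [beta], this can be expanded in the Darboux coordinates of B, which
    is how the Hamiltonian of the base acts on forms of A. *)
Lemma dR_beta_der : is_gder beta (@scalars K B) 1 (fun b => dR O (beta b)).
Proof.
split.
- by move=> a b; rewrite gmorD (gderD (dR_der O)).
- by move=> k a ha; apply: dR_deg (gmor_deg beta ha) erefl.
- by move=> s /(scalar_gmor beta)/scS; apply: dR_const.
- by move=> i j a b ha hb; rewrite gmorM (gderM (dR_der O) (gmor_deg beta ha) (gmor_deg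
  beta hb)).
Qed.

Lemma dR_H : dR O (beta (cd_H DB)) = \sum_p
  (cd (src_y DA p) *: dR O (src_x DA p) + cd (src_x DA p) *: dR O (src_y DA p)).
Proof.
rewrite (der_hamiltonian DB dR_beta_der nshift_odd (cd_H_deg DB)).
rewrite !big_sumType /= [X in _ + X = _]big1 ?addr0; last first.
  by case=> _; rewrite base_Hz raddf0 scale0r.
rewrite big_split /=; congr (_ + _); apply: eq_bigr => p _.
  by rewrite src_xE src_yE -cmor_d (cd_dy DB).
by rewrite src_xE src_yE -cmor_d base_dx.
Qed.

Lemma src_x_deg p : gdeg (deg_pos p) (src_x DA p).
Proof. exact: (sc_w_deg DA (cb q (cx p))). Qed.

Lemma src_y_deg p : gdeg (n - deg_pos p) (src_y DA p).
Proof. by rewrite -deg_momE; apply: (sc_w_deg DA (cb q (cy p))). Qed.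

Lemma src_z_deg : gdeg n (src_z DA).
Proof. exact: (sc_w_deg DA (cb q (cz m))). Qed.

(* The coefficient [i] of [x^{-i} y^{n+i}] disposes of the products in which
   [x] has degree 0, hence is not killed by the truncation. *)
Lemma H0_tangent_dz (charK : [pchar K] =i pred0) (C : cdga K) (pi : cdgamor A C)
    (hpi : is_H0 pi) k (X : tangent O pi) : mgr k X ->
  X (n + 1 + 1) (dR O (cd (src_z DA))) = 0.
Proof.
move=> hX; have hF := tangent_ghom hX; have hD := dR_beta_der.
have N0 : (- n)%:~R != 0 :> K.
  by rewrite /nshift opprK; have /pcharf0P -> := charK.
have hcz := gdeg_cd base_z_deg.
have hw : mgr (n + 1 + 1) (dR O (beta (cd (base_z DB)))) := gder_deg hD hcz erefl.
(* The equation for dz determines -n dz, and -n = 2l + 1 is invertible in characteristic zero. *)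
rewrite src_zE -cmor_d; apply/eqP; rewrite -[_ == _]orFb -(negbTE N0) -scaler_eq0.
apply/eqP; rewrite -[LHS]mulr_algl.
rewrite -[LHS](ghomK hF) // -(gderK _ hD hcz) (cd_dz DB) (gderD hD).
have hH : mgr (n + 1 + 1) (dR O (beta (cd_H DB))) := gder_deg hD (cd_H_deg DB) erefl.
have hxy p : gdeg n (base_x DB p * base_y DB p).
  by apply: gdegM_eq (base_x_deg p) (base_y_deg p) _; ring.
have hdxy p := gdeg_cd (hxy p).
rewrite (gder_sum (cd_der B)) (gder_sum hD).
have hS (p : dindex m) : mgr (n + 1 + 1) (dR O (beta (cd
    (((-1) ^+ (tag p) * (tag p)%:R : K) *: (base_x DB p * base_y DB p))))).
  by rewrite cdZ (gderK _ hD (hdxy p)); apply: gmodZ (gdeg_scalar _ _) (gder_deg hD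
    (hdxy p) erefl) _; rewrite add0r.
have xd p := dR_deg O (src_x_deg p) erefl; have yd p := dR_deg O (src_y_deg p) erefl.
have cxd p := gdeg_cd (src_x_deg p); have cyd p := gdeg_cd (src_y_deg p).
have h1 p : mgr (n + 1 + 1) (cd (src_y DA p) *: dR O (src_x DA p)).
  by apply: gmodZ (cyd p) (xd p) _; ring.
have h2 p : mgr (n + 1 + 1) (cd (src_x DA p) *: dR O (src_y DA p)).
  by apply: gmodZ (cxd p) (yd p) _; ring.
(* All coefficients of dR H are boundaries, hence vanish in the truncation. *)
have hXH : X (n + 1 + 1) (dR O (beta (cd_H DB))) = 0.
  rewrite dR_H (ghom_sum hF) => [|p _]; last by apply: gmodD.
  rewrite big1 // => p _.
  rewrite (ghomD hF) // (ghomZ hF (cyd p) (xd p)) ?(ghomZ hF (cxd p) (yd p));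
    [|ring|ring].
  by rewrite !(H0_cd hpi) !scale0r !ksgn0 addr0.
rewrite (ghomD hF) //; last exact: gmod_sum.
rewrite hXH add0r (ghom_sum hF) // big1 // => p _; rewrite cdZ (gderK _ hD (hdxy p)).
have hm := gder_deg hD (hdxy p) erefl; rewrite (ghomK hF) //.
case: (posnP (tag p)) => [->|tp]; first by rewrite mulr0 !scale0r.
have px : pi (src_x DA p) = 0.
  by apply: (H0_neg hpi (src_x_deg p)); rewrite /deg_pos oppr_lt0 ltz_nat.
have py : pi (src_y DA p) = 0.
  by apply: (H0_neg hpi (src_y_deg p)); rewrite subr_lt0 nshift_lt.
rewrite (cdM _ (base_x_deg p)) gmorD gmor_ksgn !gmorM !cmor_d -src_xE -src_yE.
rewrite (gderD (dR_der O)) (gder_ksgn (dR_der O)).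
have h3 : mgr (n + 1 + 1) (dR O (cd (src_x DA p) * src_y DA p)).
  by apply: dR_deg (gdegM (cxd p) (src_y_deg p)) _; ring.
have h4 : mgr (n + 1 + 1) (dR O (src_x DA p * cd (src_y DA p))).
  by apply: dR_deg (gdegM (src_x_deg p) (cyd p)) _; ring.
rewrite (ghomD hF) ?(ghom_ksgn hF) //; last exact: gmod_ksgn.
rewrite (H0_tangent_dRM hX (cxd p) (src_y_deg p)) ?(H0_cd hpi) //; last by ring.
rewrite (H0_tangent_dRM hX (src_x_deg p) (cyd p)) ?(H0_cd hpi) //; last by ring.
by rewrite ksgn0 addr0 scaler0.
Qed.

End Forms.

(** * Darboux frames of the source, absolute and relative *)

Definition total_index : finType := (dindex q + dindex m)%type.

Definition total_u (p : total_index) : A :=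
  match p with inl p => src_u DA p | inr p => src_x DA p end.

Definition total_v (p : total_index) : A :=
  match p with inl p => src_v DA p | inr p => src_y DA p end.

Definition total_deg (p : total_index) : int :=
  match p with inl p => deg_pos p | inr p => deg_pos p end.

Lemma absolute_frame (OA : deRham (scalars (A := A))) :
  frame OA (fun j : total_index + total_index + unit =>
      match j with inl (inl p) => total_deg p | inl (inr p) => n - total_deg p | inr _
        => n end)
    (fun j => match j with inl (inl p) => total_u p | inl (inr p) => total_v p | inr _
      => src_z DA end).
Proof.
pose e (j : total_index + total_index + unit) : acoord m q :=
  match j with
  | inl (inl (inl p)) => cu m p | inl (inl (inr p)) => cb q (cx p)
  | inl (inr (inl p)) => cv m p | inl (inr (inr p)) => cb q (cy p)
  | inr _ => cb q (cz m)
  end.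
pose e' (c : acoord m q) : total_index + total_index + unit :=
  match c with
  | inr (inl p) => inl (inl (inl p)) | inl (inl (inl p)) => inl (inl (inr p))
  | inr (inr p) => inl (inr (inl p)) | inl (inl (inr p)) => inl (inr (inr p))
  | inl (inr _) => inr tt
  end.
have eK : cancel e e' by case=> [[[p|p]|[p|p]]|[]].
have e'K : cancel e' e by case=> [[[p|p]|[]]|[p|p]].
apply: (@frame_eq K A _ OA _ (adeg (m := m) (q := q) \o e) _ (sc_w DA \o e)).
- by case=> [[[p|p]|[p|p]]|[]] //=; rewrite deg_momE.
- by case=> [[[p|p]|[p|p]]|[]].
apply: (coords_frame (fun s hs => hs) (can_inj eK)) => [j s|c].
  exact: (gder_const (sc_D_der DA (e j))).
by rewrite -(e'K c) codom_f.
Qed.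

Lemma image_scalars (s : A) : scalars s -> image_of beta s.
Proof. by case=> k ->; exists k%:A; rewrite linearZ rmorph1. Qed.

(** The composite is a derivation on B killing every coordinate, so its expansion is zero; this
    covers B(0) too, whose elements need not be polynomials in the coordinates. *)
Lemma fiber_D_beta (c : dindex q + dindex q) b : sc_D DA (inr c) (beta b) = 0.
Proof.
have hD : is_gder (M := reg A) beta (@scalars K B) (- adeg (m := m) (inr c))
    (fun b => sc_D DA (inr c) (beta b)).
  have hDc := sc_D_der DA (inr c); split.
  - by move=> a a'; rewrite gmorD (gderD hDc).
  - by move=> k a ha; apply: (gder_deg hDc (gmor_deg beta ha)).
  - by move=> s /(scalar_gmor beta); apply: (gder_const hDc).
  - by move=> i j a a' ha ha'; rewrite gmorM (gderM hDc (gmor_deg beta ha) (gmor_deg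
    beta ha')).
have [N [h [hh ->]]] := gdeg_dec b.
rewrite (gder_sum hD) big1 // => k _; rewrite [LHS](der_expansion DB hD (hh k)).
rewrite big1 // => c' _; rewrite -(ds_base DA) sc_D_w /=.
by rewrite scaler0 ksgn0.
Qed.

(** The coordinates coming from B are constants of the relative de Rham algebra, and [fiber_D_beta]
    lets the partial derivatives along the fibre descend to it. *)
Lemma relative_frame (OAB : deRham (image_of beta)) :
  frame OAB (fun j : dindex q + dindex q =>
      match j with inl p => deg_pos p | inr p => n - deg_pos p end)
    (fun j => match j with inl p => src_u DA p | inr p => src_v DA p end).
Proof.
pose e (j : dindex q + dindex q) : acoord m q := inr j.
apply: (@frame_eq K A _ OAB _ (adeg (m := m) (q := q) \o e) _ (sc_w DA \o e)).
- by case=> p //=; rewrite deg_momE.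
- by case.
apply: (coords_frame image_scalars) => [j j' []//|j s [b ->]|[c|c]].
- exact: fiber_D_beta.
- by move=> _; apply: dR_const; exists (sc_w DB c); rewrite -(ds_base DA).
- by rewrite -/(e c) codom_f.
Qed.

(** The pullback of the contact form of B is exactly the base part of Omega^0, so adding [c] times
    it rescales the pairs (x, y) and the term in z by [1 + c] and leaves the pairs (u, v) alone. *)
Lemma total_form (OA : deRham (scalars (A := A))) (OB : deRham (scalars (A := B))) c :
  \sum_(p : dindex q) src_v DA p *: dR OA (src_u DA p)
  + \sum_(p : dindex m) src_y DA p *: dR OA (src_x DA p) + dR OA (src_z DA)
  + (c%:A : A) *: pullback beta OA n (contact_form DB OB) =
  darboux_form OA total_u total_v (src_z DA)
    (fun p => if p is inl _ then 1 else 1 + c) (1 + c).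
Proof.
have [hL eL] := @om1_liftP K B _ OB A beta (om1 OA) _ _ (dR_beta_der OA (fun s h => h)).
have xd p := dR_deg OB (base_x_deg p) erefl; have zd := dR_deg OB base_z_deg erefl.
have -> : pullback beta OA n (contact_form DB OB) =
    dR OA (src_z DA) + \sum_(p : dindex m) src_y DA p *: dR OA (src_x DA p).
  have hyx p : mgr (n + 1) (base_y DB p *: dR OB (base_x DB p)).
    by apply: gmodZ (base_y_deg p) (xd p) _; ring.
  rewrite /pullback /contact_form (ghomD hL) //; last exact: gmod_sum.
  rewrite (eL _ _ base_z_deg) -src_zE (ghom_sum hL) //; congr (_ + _).
  apply: eq_bigr => p _; rewrite (ghomZ hL (base_y_deg p) (xd p)); last by ring.
  by rewrite subrr mul0r ksgn_even // (eL _ _ (base_x_deg p)) -src_xE -src_yE.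
rewrite /darboux_form big_sumType /=.
under eq_bigr do rewrite scale1r scale1r.
rewrite -scaler_sumr scalerDl scale1r !scalerDl !scale1r -!addrA; congr (_ + _).
by rewrite scalerDr; congr (_ + _); rewrite [RHS]addrCA; congr (_ + _); apply: addrC.
Qed.

Lemma total_u_deg p : gdeg (total_deg p) (total_u p).
Proof. by case: p => p; [apply: src_u_deg|apply: src_x_deg]. Qed.

Lemma total_v_deg p : gdeg (n - total_deg p) (total_v p).
Proof. by case: p => p; [apply: src_v_deg|apply: src_y_deg]. Qed.

Lemma total_deg_gt p : n < total_deg p.
Proof. by case: p => p; apply: nshift_lt. Qed.

Lemma fiber_2form_closed (S : A -> Prop) (O : deRham S) :
  (forall s : A, scalars s -> S s) ->
  md (n + 2) (\sum_(p : dindex q) wedge (dR O (src_v DA p)) (dR O (src_u DA p))) = 0.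
Proof.
move=> scS; apply: hamiltonian_closed (dR_G O scS); first exact: nshift_odd.
- exact: src_u_deg.
- exact: src_v_deg.
- exact: ds_G_deg.
Qed.

Lemma base_2form_closed (S : A -> Prop) (O : deRham S) :
  (forall s : A, scalars s -> S s) ->
  md (n + 2) (\sum_(p : dindex m) wedge (dR O (src_y DA p)) (dR O (src_x DA p))) = 0.
Proof.
move=> scS; apply: hamiltonian_closed (dR_H O scS); first exact: nshift_odd.
- exact: src_x_deg.
- exact: src_y_deg.
- by apply: gmor_deg; apply: cd_H_deg.
Qed.

(** The fibre and base halves are closed separately, by G and by the image of H, so they may carry
    different constant weights. *)
Lemma total_2form_closed (OA : deRham (scalars (A := A))) c :
  md (n + 2) (darboux_2form OA total_u total_v
    (fun p => if p is inl _ then 1 else 1 + c)) = 0.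
Proof.
have hw p : mgr (n + 2) (wedge (dR OA (total_v p)) (dR OA (total_u p))).
  by apply: wedge_deg (dR_deg OA (total_v_deg p) erefl) (dR_deg OA (total_u_deg p)
    erefl) _; ring.
have scA : forall s : A, scalars s -> scalars s by [].
rewrite /darboux_2form big_sumType /= -!scaler_sumr md_add; last 2 first.
- by apply: gmodK; apply: gmod_sum => p _; apply: (hw (inl p)).
- by apply: gmodK; apply: gmod_sum => p _; apply: (hw (inr p)).
rewrite !md_K.
- by rewrite fiber_2form_closed // base_2form_closed // !scaler0 addr0.
- by apply: gmod_sum => p _; apply: (hw (inr p)).
- by apply: gmod_sum => p _; apply: (hw (inl p)).
Qed.

End Submersion.

(** * The exact symplectic fibration and the contact structure on its total space *)

Theorem theorem4 (K : closedFieldType) (charK : [pchar K] =i pred0)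
    (l : nat) (m q : 'I_l.+1 -> nat)
    (B : cdga K) (DB : contact_darboux m B)
    (A : cdga K) (DA : darboux_submersion q DB A)
    (OB : deRham (scalars (A := B)))
    (OA : deRham (scalars (A := A)))
    (OAB : deRham (image_of (ds_beta DA))) :
  let n : int := nshift l in
  let lambda_rel : om1 OAB :=
    \sum_(p : dindex q) src_v DA p *: dR OAB (src_u DA p) in
  let gamma : om2 OAB :=
    \sum_(p : dindex q)
      wedge (dR OAB (src_v DA p)) (dR OAB (src_u DA p)) in
  let sigma0 : om1 OB := contact_form DB OB in
  let Omega0 : om1 OA :=
    \sum_(p : dindex q) src_v DA p *: dR OA (src_u DA p)
    + \sum_(p : dindex m) src_y DA p *: dR OA (src_x DA p)
    + dR OA (src_z DA) in
  (is_exact_symplectic_fibration n lambda_rel /\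
   dR1 (n + 1) lambda_rel = gamma) /\
  (forall c : K, c != -1 ->
     is_contact n
       (Omega0 + (c%:A : A) *: pullback (ds_beta DA) OA n sigma0)).
Proof.
move=> n lambda_rel gamma sigma0 Omega0; split.
  have hvu (p : dindex q) : mgr (n + 1) (src_v DA p *: dR OAB (src_u DA p)).
    by apply: adR_deg (src_v_deg DA p) (src_u_deg DA p) _; ring.
  have egamma : dR1 (n + 1) lambda_rel = gamma.
    rewrite dR1_sum //; apply: eq_bigr => p _.
    by apply: dR1_adR (src_v_deg DA p) (src_u_deg DA p) _; ring.
  have closed : md (n + 2) gamma = 0 by apply: fiber_2form_closed (image_scalars DA).
  split=> //; rewrite /is_exact_symplectic_fibration egamma; split=> //.
    exact: gmod_sum.
  exact: contraction_equivalence (src_u_deg DA) (src_v_deg DA) closed (relative_frame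
    OAB).
move=> c c1; rewrite /Omega0 /sigma0 total_form.
have c0 : 1 + c != 0 by rewrite addrC addr_eq0.
pose kap (p : total_index m q) : K := if p is inl _ then 1 else 1 + c.
have kap0 p : kap p != 0 by case: p => p //=; apply: oner_neq0.
have F := absolute_frame DA OA.
have nle (p : total_index m q) : nshift l <= total_deg p := ltW (total_deg_gt p).
have hle (p : total_index m q) : total_deg p <= 0 by case: p => p; apply: deg_pos_le0.
have scA : forall s : A, scalars s -> scalars s by [].
(* Both clauses of the contact condition reduce to closedness on the coefficients: proved over the
   truncation, assumed over A. *)
have contact (C : cdga K) (pi : cdgamor A C) :
    closed_on pi n (darboux_form OA (total_u DA) (total_v DA) (src_z DA) kap (1 + c)) ->
    contact_over pi n (darboux_form OA (total_u DA) (total_v DA) (src_z DA) kap (1 +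
      c)).
  move=> hcl; exists (darboux_form_deg kap (1 + c) F), hcl.
  rewrite (dR1_darboux_form scA _ _ F).
  have hom : md (nshift l + 2) (darboux_2form OA (total_u DA) (total_v DA) kap) = 0.
    exact: total_2form_closed.
  have := fib_pairing_equivalence kap0 c0 hle nle F hom (darboux_form_deg kap (1 + c)
    F) hcl.
  exact.
split; first exact: darboux_form_deg F.
  move=> C pi hpi; apply: contact.
  apply: (darboux_form_closed_on kap (1 + c) (fun p : total_index m q => total_deg_gt p)
    (total_u_deg DA) (total_v_deg DA) (src_z_deg DA) hpi) => k X hX.
  exact: H0_tangent_dz hX.
move=> dalpha; apply: contact => k X hX; rewrite [md _ _]dalpha.
exact: (ghom0 (tangent_ghom hX)).
Qed.
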